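(* Core spanners can be maintained in $\mathsf{DynCQ}$: for every core spanner $P$, the spanner relation $R^P$ can be maintained by a dynamic program whose update formulas are conjunctive queries.
   Context: Spanners: for $w=a_1\cdots a_n$ a span $[i,j\rangle$ ($1\le i\le j\le n+1$) denotes $a_i\cdots a_{j-1}$; a spanner $P$ with $\mathrm{SVars}(P)=V$ maps $w$ to a set of functions $\mu$ from $V$ to spans. Core spanners are obtained from regex formulas (regular expressions with variable bindings $x\{\gamma\}$, each variable bound exactly once per match) by closure under union, projection, natural join and equality selection $\zeta^=_{x,y}$ (keep $\mu$ with $w_{\mu(x)}=w_{\mu(y)}$). Dynamic setting: word-structure with domain $D=\{1,\dots,n+1\}$, order $<$, constant $\$=n+1$, unary $P_a$ ($a\in\Sigma$), each position $\le n$ carrying at most one letter, $\$$ none; $\mathrm{word}(\mathfrak W)$ is the concatenation of letters in order; $\mathrm{pos}(x)$ of a letter-carrying position $x$ is the number of letter-carrying positions $\le x$. Updates $\mathrm{ins}_a(i)$ and $\mathrm{reset}(i)$ set/clear the letter at $i\ne\$$ (must change the word). A dynamic program: auxiliary relations over $D$ initialized by first-order formulas on the initially empty structure, updated by update formulas $\phi(u;\bar x)$ evaluated on the updated word structure and old auxiliary relations; it maintains a relation if a designated auxiliary relation always equals it. $\mathsf{DynCQ}$: update formulas are conjunctive queries. Spanner relation $R^P$ for $\mathrm{SVars}(P)=\{x_1,\dots,x_k\}$: the $2k$-ary relation of tuples $(\hat x_1,\check x_1,\dots,\hat x_k,\check x_k)$ with $\mu(x_i)=[\mathrm{pos}(\hat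 x_i),\mathrm{pos}(\check x_i)\rangle$ for some $\mu\in P(\mathrm{word}(\mathfrak W))$, except that $\check x_i=\$$ when $\mu(x_i)=[j,|w|+1\rangle$. *)

(* Defs.v *)
From mathcomp Require Import all_boot.
From mathcomp Require Import finmap.

Set Implicit Arguments.
Unset Strict Implicit.
Unset Printing Implicit Defensive.

Local Open Scope fset_scope.
Local Open Scope fmap_scope.

(** * Document spanners *)

Definition var := nat.

(* (i, j) stands for the span [i, j>, with positions numbered from 1. *)
Definition span := (nat * nat)%type.

Definition is_span (T : Type) (w : seq T) (s : span) : bool :=
  (1 <= s.1) && (s.1 <= s.2) && (s.2 <= (size w).+1).

(* w_[i,j> = a_i ... a_(j-1). *)
Definition factor (T : Type) (w : seq T) (s : span) : seq T :=
  drop s.1.-1 (take s.2.-1 w).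

Definition span_tuple := {fmap var -> span}.

Definition is_span_tuple (T : Type) (V : {fset var}) (w : seq T)
    (mu : span_tuple) : Prop :=
  domf mu = V /\ (forall x s, mu.[? x] = Some s -> is_span w s).

Record spanner (Sigma : finType) := Spanner {
  svars : {fset var};
  sem :> seq Sigma -> span_tuple -> Prop;
  semP : forall w mu, sem w mu -> is_span_tuple svars w mu }.

(** ** Regex formulas, with semantics given by ref-words *)

Inductive regex (Sigma : finType) :=
| REmpty
| REps
| RLetter of Sigma
| RAlt of regex Sigma & regex Sigma
| RCat of regex Sigma & regex Sigma
| RStar of regex Sigma
| RBind of var & regex Sigma.
Arguments REmpty {Sigma}.
Arguments REps {Sigma}.

Fixpoint rvars (Sigma : finType) (g : regex Sigma) : {fset var} :=
  match g with
  | REmpty | REps | RLetter _ => fset0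
  | RAlt g1 g2 | RCat g1 g2 => rvars g1 `|` rvars g2
  | RStar g1 => rvars g1
  | RBind x g1 => x |` rvars g1
  end.

(* A ref-word is a word over the letters and the variable brackets. *)
Inductive refsym (Sigma : finType) :=
| Letter of Sigma
| Open of var
| Close of var.
Arguments Open {Sigma}.
Arguments Close {Sigma}.

Definition is_open (Sigma : finType) (x : var) (c : refsym Sigma) : bool :=
  if c is Open y then y == x else false.
Definition is_close (Sigma : finType) (x : var) (c : refsym Sigma) : bool :=
  if c is Close y then y == x else false.

Fixpoint reflang (Sigma : finType) (g : regex Sigma) (r : seq (refsym Sigma)) :
    Prop :=
  match g with
  | REmpty => False
  | REps => r = [::]
  | RLetter a => r = [:: Letter a]
  | RAlt g1 g2 => reflang g1 r \/ reflang g2 r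
  | RCat g1 g2 =>
      exists r1 r2, [/\ r = r1 ++ r2, reflang g1 r1 & reflang g2 r2]
  | RStar g1 =>
      exists rs : seq (seq (refsym Sigma)),
        r = flatten rs /\ foldr (fun s P => reflang g1 s /\ P) True rs
  | RBind x g1 =>
      exists2 r1, r = Open x :: rcons r1 (Close x) & reflang g1 r1
  end.

Definition letters (Sigma : finType) (r : seq (refsym Sigma)) : seq Sigma :=
  pmap (fun c => if c is Letter a then Some a else None) r.

Definition valid_ref (Sigma : finType) (V : {fset var})
    (r : seq (refsym Sigma)) : Prop :=
  forall x, x \in V ->
    [/\ count (is_open x) r = 1, count (is_close x) r = 1
      & find (is_open x) r < find (is_close x) r].

(* Every variable of g is bound exactly once in every match. *)
Definition functional (Sigma : finType) (g : regex Sigma) : Prop :=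
  forall r, reflang g r -> valid_ref (rvars g) r.

Definition ref_span (Sigma : finType) (r : seq (refsym Sigma)) (x : var) :
    span :=
  ((size (letters (take (find (is_open x) r) r))).+1,
   (size (letters (take (find (is_close x) r) r))).+1).

Definition ref_tuple (Sigma : finType) (V : {fset var})
    (r : seq (refsym Sigma)) : span_tuple :=
  [fmap x : V => ref_span r (val x)].

(* For functional g the conjunct valid_ref is redundant; it makes the operation
   total on regex. *)
Definition regex_sem (Sigma : finType) (g : regex Sigma) (w : seq Sigma)
    (mu : span_tuple) : Prop :=
  exists r, [/\ reflang g r, valid_ref (rvars g) r, letters r = w
              & mu = ref_tuple (rvars g) r].

Lemma size_letters_take (Sigma : finType) (r : seq (refsym Sigma)) i j :
  i <= j -> size (letters (take i r)) <= size (letters (take j r)).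
Proof.
move=> le_ij; rewrite -(cat_take_drop i (take j r)) take_takel //.
by rewrite /letters pmap_cat size_cat leq_addr.
Qed.

Lemma regex_semP (Sigma : finType) (g : regex Sigma) w mu :
  regex_sem g w mu -> is_span_tuple (rvars g) w mu.
Proof.
case=> r [_ rV <- ->]; split=> // x s; case: fndP => // xV [<-].
rewrite ffunE /is_span /= ltnS size_letters_take; last first.
  by have [_ _ /ltnW] := rV x xV.
have := size_letters_take r (find_size (is_close x) r).
by rewrite take_size ltnS.
Qed.

Definition regex_spanner (Sigma : finType) (g : regex Sigma) : spanner Sigma :=
  Spanner (@regex_semP Sigma g).

(** ** Spanner algebra *)

Definition union_sem (Sigma : finType) (P1 P2 : spanner Sigma)
    (w : seq Sigma) (mu : span_tuple) : Prop :=
  P1 w mu \/ P2 w mu.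

Lemma union_semP (Sigma : finType) (P1 P2 : spanner Sigma)
    (eqV : svars P1 = svars P2) w mu :
  union_sem P1 P2 w mu -> is_span_tuple (svars P1) w mu.
Proof. by case=> /semP; rewrite -?eqV. Qed.

Definition union_spanner (Sigma : finType) (P1 P2 : spanner Sigma)
    (eqV : svars P1 = svars P2) : spanner Sigma :=
  Spanner (union_semP eqV).

Definition proj_sem (Sigma : finType) (Y : {fset var}) (P : spanner Sigma)
    (w : seq Sigma) (mu : span_tuple) : Prop :=
  exists2 nu, P w nu & mu = nu.[& Y].

Lemma proj_semP (Sigma : finType) (Y : {fset var}) (P : spanner Sigma)
    (subY : Y `<=` svars P) w mu :
  proj_sem Y P w mu -> is_span_tuple Y w mu.
Proof.
case=> nu /semP[domV nuw] ->; split=> [|x s].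
  by rewrite domf_restrict domV; apply/fsetIidPl.
by rewrite fnd_restrict; case: ifP => // _; apply: nuw.
Qed.

Definition proj_spanner (Sigma : finType) (Y : {fset var}) (P : spanner Sigma)
    (subY : Y `<=` svars P) : spanner Sigma :=
  Spanner (proj_semP subY).

Definition join_sem (Sigma : finType) (P1 P2 : spanner Sigma)
    (w : seq Sigma) (mu : span_tuple) : Prop :=
  [/\ domf mu = svars P1 `|` svars P2, P1 w mu.[& svars P1]
    & P2 w mu.[& svars P2]].

Lemma join_semP (Sigma : finType) (P1 P2 : spanner Sigma) w mu :
  join_sem P1 P2 w mu -> is_span_tuple (svars P1 `|` svars P2) w mu.
Proof.
case=> domV /semP[_ mu1] /semP[_ mu2]; split=> // x s mux.
have: x \in svars P1 `|` svars P2 by rewrite -domV -fndSome mux.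
by rewrite in_fsetU => /orP[xV|xV]; [apply: (mu1 x) | apply: (mu2 x)];
  rewrite fnd_restrict xV.
Qed.

Definition join_spanner (Sigma : finType) (P1 P2 : spanner Sigma) :
    spanner Sigma :=
  Spanner (@join_semP Sigma P1 P2).

Definition eqsel_sem (Sigma : finType) (x y : var) (P : spanner Sigma)
    (w : seq Sigma) (mu : span_tuple) : Prop :=
  P w mu /\ omap (factor w) mu.[? x] = omap (factor w) mu.[? y].

Lemma eqsel_semP (Sigma : finType) (x y : var) (P : spanner Sigma) w mu :
  eqsel_sem x y P w mu -> is_span_tuple (svars P) w mu.
Proof. by case=> /semP. Qed.

Definition eqsel_spanner (Sigma : finType) (x y : var) (P : spanner Sigma) :
    spanner Sigma :=
  Spanner (@eqsel_semP Sigma x y P).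

Inductive core_spanner (Sigma : finType) : spanner Sigma -> Prop :=
| core_regex g : functional g -> core_spanner (regex_spanner g)
| core_union P1 P2 (eqV : svars P1 = svars P2) :
    core_spanner P1 -> core_spanner P2 -> core_spanner (union_spanner eqV)
| core_proj Y P (subY : Y `<=` svars P) :
    core_spanner P -> core_spanner (proj_spanner subY)
| core_join P1 P2 :
    core_spanner P1 -> core_spanner P2 -> core_spanner (join_spanner P1 P2)
| core_eqsel x y P :
    x \in svars P -> y \in svars P -> core_spanner P ->
    core_spanner (eqsel_spanner x y P).

(** * Word structures *)

(* The domain {1, ..., n+1} is 'I_n.+1, numbered from 0, and $ is ord_max.  Only
   the elements other than $, indexed by 'I_n through lift ord_max (which
   preserves the numerical value), may carry a letter. *)
Definition wstruct (Sigma : finType) (n : nat) := {ffun 'I_n -> option Sigma}.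

Definition elt (n : nat) (i : 'I_n) : 'I_n.+1 := lift ord_max i.

Definition letter_at (Sigma : finType) (n : nat) (W : wstruct Sigma n)
    (x : 'I_n.+1) : option Sigma :=
  obind W (unlift ord_max x).

Definition word (Sigma : finType) (n : nat) (W : wstruct Sigma n) :
    seq Sigma :=
  pmap W (enum 'I_n).

Definition pos (Sigma : finType) (n : nat) (W : wstruct Sigma n)
    (x : 'I_n.+1) : nat :=
  #|[set y : 'I_n.+1 | letter_at W y & y <= x]|.

(* x stands for the endpoint p of a span: a letter-carrying x stands for pos x,
   and $ stands for |w|+1.  Since pos x <= |w|, the endpoint |w|+1 can be
   represented by $ only. *)
Definition marks (Sigma : finType) (n : nat) (W : wstruct Sigma n)
    (x : 'I_n.+1) (p : nat) : bool :=
  if x == ord_max then p == (size (word W)).+1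
  else letter_at W x && (p == pos W x).

Inductive update_op (Sigma : finType) :=
| Ins of Sigma
| Reset.
Arguments Reset {Sigma}.

Definition op_letter (Sigma : finType) (o : update_op Sigma) : option Sigma :=
  if o is Ins a then Some a else None.

Definition empty_wstruct (Sigma : finType) (n : nat) : wstruct Sigma n :=
  [ffun=> None].

Definition apply_op (Sigma : finType) (n : nat) (W : wstruct Sigma n)
    (o : update_op Sigma) (i : 'I_n) : wstruct Sigma n :=
  [ffun j => if j == i then op_letter o else W j].

(** * First-order formulas and conjunctive queries *)

Inductive term (k : nat) :=
| Var of 'I_k
| End.
Arguments End {k}.

(* fo Sigma ar k: formulas with free variables among 0, ..., k-1 over the
   vocabulary <, $, (P_a)_(a in Sigma) and relations R : A of arity ar R.
   Variables are de Bruijn indices: a quantifier binds variable 0 of its body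
   and shifts the others. *)
Inductive fo (Sigma : finType) (A : Type) (ar : A -> nat) : nat -> Type :=
| FEq k of term k & term k : fo Sigma ar k
| FLt k of term k & term k : fo Sigma ar k
| FLetter k of Sigma & term k : fo Sigma ar k
| FRel k (R : A) of (ar R).-tuple (term k) : fo Sigma ar k
| FNot k of fo Sigma ar k : fo Sigma ar k
| FAnd k of fo Sigma ar k & fo Sigma ar k : fo Sigma ar k
| FOr k of fo Sigma ar k & fo Sigma ar k : fo Sigma ar k
| FEx k of fo Sigma ar k.+1 : fo Sigma ar k
| FAll k of fo Sigma ar k.+1 : fo Sigma ar k.

Definition interp (A : Type) (ar : A -> nat) (n : nat) :=
  forall R : A, {set (ar R).-tuple 'I_n.+1}.

Definition eval (n k : nat) (e : k.-tuple 'I_n.+1) (t : term k) : 'I_n.+1 :=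
  if t is Var v then tnth e v else ord_max.

Fixpoint sat (Sigma : finType) (A : Type) (ar : A -> nat) (n : nat)
    (W : wstruct Sigma n) (S : interp ar n) (k : nat) (phi : fo Sigma ar k) :
    k.-tuple 'I_n.+1 -> bool :=
  match phi in fo _ _ k return k.-tuple 'I_n.+1 -> bool with
  | FEq _ s t => fun e => eval e s == eval e t
  | FLt _ s t => fun e => eval e s < eval e t
  | FLetter _ a t => fun e => letter_at W (eval e t) == Some a
  | FRel _ R ts => fun e => map_tuple (eval e) ts \in S R
  | FNot _ f => fun e => ~~ sat W S f e
  | FAnd _ f g => fun e => sat W S f e && sat W S g e
  | FOr _ f g => fun e => sat W S f e || sat W S g e
  | FEx _ f => fun e => [exists d : 'I_n.+1, sat W S f (cons_tuple d e)]
  | FAll _ f => fun e => [forall d : 'I_n.+1, sat W S f (cons_tuple d e)]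
  end.

Fixpoint is_conj (Sigma : finType) (A : Type) (ar : A -> nat) (k : nat)
    (phi : fo Sigma ar k) : bool :=
  match phi with
  | FEq _ _ _ | FLt _ _ _ | FLetter _ _ _ | FRel _ _ _ => true
  | FAnd _ f g => is_conj f && is_conj g
  | _ => false
  end.

(* Existential quantifiers in front of a conjunction of atoms. *)
Fixpoint is_cq (Sigma : finType) (A : Type) (ar : A -> nat) (k : nat)
    (phi : fo Sigma ar k) : bool :=
  match phi with
  | FEx _ f => is_cq f
  | f => is_conj f
  end.

(** * Dynamic programs *)

(* Initialization formulas speak about the word structure alone.  In an update
   formula, variable 0 is the updated element and variables 1, 2, and so on are
   the components of the tuple. *)
Record dynprog (Sigma : finType) := Dynprog {
  aux : finType;
  arity : aux -> nat;
  init : forall R : aux, fo Sigma (of_void nat) (arity R);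
  update : update_op Sigma -> forall R : aux, fo Sigma arity (arity R).+1;
  out : aux }.

Definition init_aux (Sigma : finType) (p : dynprog Sigma) (n : nat) :
    interp (@arity Sigma p) n :=
  fun R => [set t | sat (empty_wstruct Sigma n)
                        (fun v : void => of_void _ v) (init R) t].

(* W is the word structure after the update, S the old auxiliary relations. *)
Definition step_aux (Sigma : finType) (p : dynprog Sigma) (n : nat)
    (W : wstruct Sigma n) (S : interp (@arity Sigma p) n)
    (o : update_op Sigma) (i : 'I_n) : interp (@arity Sigma p) n :=
  fun R => [set t | sat W S (update o R) (cons_tuple (elt i) t)].

Inductive reachable (Sigma : finType) (p : dynprog Sigma) (n : nat) :
    wstruct Sigma n -> interp (@arity Sigma p) n -> Prop :=
| reach_init : reachable (empty_wstruct Sigma n) (@init_aux Sigma p n)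
| reach_step W S o i :
    reachable W S -> word (apply_op W o i) <> word W ->
    reachable (apply_op W o i) (step_aux (apply_op W o i) S o i).

(* A relation of fixed arity on every word structure; only its value on
   sequences of that length matters. *)
Definition word_relation (Sigma : finType) :=
  forall n, wstruct Sigma n -> seq 'I_n.+1 -> Prop.

Definition maintains (Sigma : finType) (p : dynprog Sigma) (k : nat)
    (Q : word_relation Sigma) : Prop :=
  arity (out p) = k /\
  (forall n (W : wstruct Sigma n) (S : interp (@arity Sigma p) n),
     reachable W S ->
     forall t : (arity (out p)).-tuple 'I_n.+1, t \in S (out p) <-> Q n W t).

Definition in_DynCQ (Sigma : finType) (k : nat) (Q : word_relation Sigma) :
    Prop :=
  exists p : dynprog Sigma,
    (forall o (R : aux p), is_cq (update o R)) /\ maintains p k Q.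

(** * The spanner relation *)

(* xs lists the variables of P.  Components 2i and 2i+1 of t (from 0) represent
   the left and right endpoints of the span of the i-th variable. *)
Definition spanner_relation (Sigma : finType) (P : spanner Sigma)
    (xs : seq var) : word_relation Sigma :=
  fun n W t =>
    exists2 mu, P (word W) mu &
      forall i, i < size xs ->
        exists2 s, mu.[? nth 0 xs i] = Some s &
          marks W (nth ord_max t i.*2) s.1 /\
          marks W (nth ord_max t i.*2.+1) s.2.

(* Main.v *)
Require Import Defs.
From mathcomp Require Import all_boot.
From mathcomp Require Import finmap.
From HB Require Import structures.
From mathcomp Require Import zify.
From Stdlib Require Import Classical_Prop.

Set Implicit Arguments.
Unset Strict Implicit.
Unset Printing Implicit Defensive.

(** A conjunctive query has no disjunction, so every relation R is stored in the
    guarded form R^(d, t) := d <> $ \/ R t.  A disjunction then becomes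
    conjunctive: (Q1 \/ Q2)^(d) holds iff there are d1, d2 with Q1^(d1), Q2^(d2)
    and (d1 = $ \/ d2 = $)^(d); for d <> $ one may take d1 and d2 to be the
    updated element, which is not $.  Hence positive existential update formulas
    suffice.

    The stored relations are the order, the letters, the runs of an automaton on
    the factor between two elements, and equality of two factors.  A factor of
    the updated word splits at the updated position into factors of the old word
    and at most one letter; runs on such a concatenation, and equality of two of
    them, are definable from the old relations by guessing intermediate states
    and cut points.  All regex formulas of the spanner are read by one automaton
    on ref-words: a tuple is selected iff for some order of the variable
    brackets there is an accepting run that reads each bracket at its element
    and, in between, the factors of the word.  The spanner operations are positive
    existential over these relations. *)

(** * Finite automata *)

Section Nfa.
Variable C : Type.

Record nfa := Nfa {
  state : finType;
  step : state -> C -> state -> bool;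
  final : pred state }.

Section Run.
Variable N : nfa.

Fixpoint run (p : state N) (w : seq C) (q : state N) : bool :=
  if w is c :: w' then [exists m, step p c m && run m w' q] else p == q.

Lemma run_cons p c w q : run p (c :: w) q = [exists m, step p c m && run m w q].
Proof. by []. Qed.

Lemma run_cat (p q : state N) w1 w2 :
  run p (w1 ++ w2) q = [exists m, run p w1 m && run m w2 q].
Proof.
elim: w1 p => [|c w1 IH] p.
  by apply/idP/existsP=> [pq|[m /andP[/eqP-> //]]]; exists p; rewrite /= eqxx.
rewrite cat_cons run_cons.
apply/existsP/existsP=> [[m /andP[pm]]|[m /andP[/existsP[l /andP[pl lm]] mq]]].
  rewrite IH => /existsP[l /andP[ml lq]]; exists l; rewrite lq andbT run_cons.
  by apply/existsP; exists m; rewrite pm.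
by exists l; rewrite pl IH; apply/existsP; exists m; apply/andP.
Qed.

Definition accepts (p : state N) (w : seq C) : bool :=
  [exists q, run p w q && final q].

Lemma accepts_nil (p : state N) : accepts p [::] = final p.
Proof.
by apply/existsP/idP=> [[q /andP[/eqP-> //]]|fp]; exists p; rewrite /= eqxx.
Qed.

Lemma accepts_cons (p : state N) c w :
  accepts p (c :: w) = [exists m, step p c m && accepts m w].
Proof.
apply/existsP/existsP=> [[q /andP[]]|].
  rewrite run_cons => /existsP[m /andP[pm mq]] fq.
  by exists m; rewrite pm; apply/existsP; exists q; rewrite mq.
case=> m /andP[pm /existsP[q /andP[mq fq]]]; exists q; rewrite fq andbT.
by rewrite run_cons; apply/existsP; exists m; rewrite pm.
Qed.

End Run.

(** The initial states belong to the language and not to the automaton, so that a single automaton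
    can recognize several languages. *)
Definition recognizes (N : nfa) (L : seq C -> Prop) : Prop :=
  exists I : {set state N}, forall w,
    L w <-> exists2 q, q \in I & accepts q w.

Definition regular (L : seq C -> Prop) : Prop := exists N, recognizes N L.

Lemma regular_iff L1 L2 :
  (forall w, L1 w <-> L2 w) -> regular L1 -> regular L2.
Proof.
move=> L12 [N [I NI]]; exists N, I => w.
by split=> [/L12/NI|/NI/L12].
Qed.

Lemma regular_empty : regular (fun=> False).
Proof.
exists (@Nfa void (fun _ _ _ => false) (fun=> false)), set0 => w.
by split=> [[]|[[]]].
Qed.

Lemma regular_eps : regular (fun w => w = [::]).
Proof.
exists (@Nfa unit (fun _ _ _ => false) (fun=> true)), setT => w.
split=> [->|[[] _]]; first by exists tt; rewrite ?inE // accepts_nil.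
by case: w => // c w; rewrite accepts_cons => /existsP[m].
Qed.

(** The alphabet is a bare type without a boolean equality; [P] serves as the test for [c] in the
    transition function. *)
Lemma regular_sym (P : pred C) (c : C) :
  (forall b, P b <-> b = c) -> regular (fun w => w = [:: c]).
Proof.
move=> Pc.
exists (@Nfa bool (fun p b q => [&& ~~ p, q & P b]) (fun p => p)), [set false].
move=> w; split=> [->|[q]].
  exists false; rewrite ?inE // accepts_cons; apply/existsP; exists true.
  by rewrite accepts_nil /= andbT; apply/Pc.
rewrite inE => /eqP->; case: w => [|b w]; first by rewrite accepts_nil.
rewrite accepts_cons => /existsP[m /=]; case: m => //= /andP[/Pc->].
by case: w => // d w; rewrite accepts_cons => /existsP[].
Qed.

Section Sum.
Variables N1 N2 : nfa.

Definition sum_nfa : nfa :=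
  @Nfa (state N1 + state N2)%type
    (fun p c q => match p, q with
                  | inl p, inl q => step p c q
                  | inr p, inr q => step p c q
                  | _, _ => false end)
    (fun p => match p with inl p => final p | inr p => final p end).

Lemma sum_accepts_inl p w : @accepts sum_nfa (inl p) w = accepts p w.
Proof.
elim: w p => [|c w IH] p; first by rewrite !accepts_nil.
rewrite !accepts_cons; apply/existsP/existsP=> [[[m|m]] //=|[m]].
  by rewrite IH; exists m.
by rewrite -IH; exists (inl m).
Qed.

Lemma sum_accepts_inr p w : @accepts sum_nfa (inr p) w = accepts p w.
Proof.
elim: w p => [|c w IH] p; first by rewrite !accepts_nil.
rewrite !accepts_cons; apply/existsP/existsP=> [[[m|m]] //=|[m]].
  by rewrite IH; exists m.
by rewrite -IH; exists (inr m).
Qed.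

(** Runs of the disjoint sum never leave the component where they start, so the choice of initial
    states selects the component. *)
Lemma recognizes_inl L : recognizes N1 L -> recognizes sum_nfa L.
Proof.
case=> I NI; exists (inl @: I) => w; split=> [/NI[q qI]|].
  by exists (inl q); rewrite ?imset_f ?sum_accepts_inl.
case=> _ /imsetP[q qI ->]; rewrite sum_accepts_inl => qw.
by apply/NI; exists q.
Qed.

Lemma recognizes_inr L : recognizes N2 L -> recognizes sum_nfa L.
Proof.
case=> I NI; exists (inr @: I) => w; split=> [/NI[q qI]|].
  by exists (inr q); rewrite ?imset_f ?sum_accepts_inr.
case=> _ /imsetP[q qI ->]; rewrite sum_accepts_inr => qw.
by apply/NI; exists q.
Qed.

End Sum.

Lemma recognizes_union N L1 L2 :
  recognizes N L1 -> recognizes N L2 ->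
  recognizes N (fun w => L1 w \/ L2 w).
Proof.
case=> [I1 NI1] [I2 NI2]; exists (I1 :|: I2) => w; split.
  by case=> [/NI1|/NI2] [q qI qw]; exists q; rewrite ?inE ?qI ?orbT.
by case=> q /setUP[] qI qw; [left; apply/NI1|right; apply/NI2]; exists q.
Qed.

Lemma regular_union L1 L2 :
  regular L1 -> regular L2 -> regular (fun w => L1 w \/ L2 w).
Proof.
case=> [N1 NL1] [N2 NL2]; exists (sum_nfa N1 N2).
by apply: recognizes_union; [apply: recognizes_inl | apply: recognizes_inr].
Qed.

Definition cat_lang (L1 L2 : seq C -> Prop) (w : seq C) : Prop :=
  exists w1 w2, [/\ w = w1 ++ w2, L1 w1 & L2 w2].

(** The automata have no empty moves. A final state of the first automaton therefore simulates
    directly a first step of the second one, and stays final only if the second one accepts the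
    empty word. *)
Lemma regular_cat L1 L2 : regular L1 -> regular L2 -> regular (cat_lang L1 L2).
Proof.
case=> [N1 [I1 NL1]] [N2 [I2 NL2]].
pose enter c q := [exists i in I2, @step N2 i c q].
pose N := @Nfa (state N1 + state N2)%type
  (fun p c q => match p, q with
                | inl p, inl q => step p c q
                | inl p, inr q => final p && enter c q
                | inr p, inr q => step p c q
                | inr _, inl _ => false end)
  (fun p => match p with
            | inl p => final p && [exists i in I2, final i]
            | inr p => final p end).
have acc2 q w : @accepts N (inr q) w = accepts q w.
  elim: w q => [|c w IH] q; first by rewrite !accepts_nil.
  rewrite !accepts_cons; apply/existsP/existsP=> [[[m|m]] //=|[m]].
    by rewrite IH; exists m.
  by rewrite -IH; exists (inr m).
have acc1 w q : @accepts N (inl q) w <-> cat_lang (accepts q) L2 w.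
  elim: w q => [|c w IH] q.
    rewrite accepts_nil /=; split.
      case/andP=> fq /existsP[i /andP[iI fi]]; exists [::], [::].
      by rewrite accepts_nil; split=> //; apply/NL2; exists i; rewrite ?accepts_nil.
    case=> w1 [w2 [/esym/nilP]]; rewrite cat_nilp => /andP[/nilP-> /nilP->].
    rewrite !accepts_nil => fq /NL2[i iI fi].
    rewrite fq; apply/existsP; exists i.
    by rewrite iI -accepts_nil.
  rewrite accepts_cons; split.
    case/existsP=> [] [m|m] /= /andP[qm].
      case/IH=> w1 [w2 [-> mw1 Lw2]]; exists (c :: w1), w2; split=> //.
      by rewrite accepts_cons; apply/existsP; exists m; rewrite qm.
    rewrite acc2 => mw; case/andP: qm => fq /existsP[i /andP[iI im]].
    exists [::], (c :: w); split; rewrite ?accepts_nil //.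
    apply/NL2; exists i => //; rewrite accepts_cons.
    by apply/existsP; exists m; rewrite im.
  case=> [[|c1 w1] [w2 [/= def_w qw1 Lw2]]].
    rewrite accepts_nil in qw1; move: Lw2; rewrite -def_w => /NL2[i iI].
    rewrite accepts_cons => /existsP[m /andP[im mw]].
    apply/existsP; exists (inr m); rewrite acc2 mw andbT /= qw1.
    by apply/existsP; exists i; rewrite iI.
  case: def_w => -> def_w; move: qw1; rewrite accepts_cons.
  case/existsP=> m /andP[qm mw1]; apply/existsP; exists (inl m).
  by rewrite /= qm /=; apply/IH; exists w1, w2.
exists N, (inl @: I1) => w; split.
  case=> w1 [w2 [-> /NL1[q qI qw1] Lw2]]; exists (inl q); first exact: imset_f.
  by apply/acc1; exists w1, w2.
case=> _ /imsetP[q qI ->] /acc1[w1 [w2 [-> qw1 Lw2]]].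
by exists w1, w2; split=> //; apply/NL1; exists q.
Qed.

Definition star_lang (L : seq C -> Prop) (w : seq C) : Prop :=
  exists ws : seq (seq C),
    w = flatten ws /\ foldr (fun v P => L v /\ P) True ws.

(** Empty factors at the front of a decomposition can be skipped, so the first nonempty one starts
    with [c]. *)
Lemma star_lang_cons L c w :
  star_lang L (c :: w) <->
  exists w1 w2, [/\ w = w1 ++ w2, L (c :: w1) & star_lang L w2].
Proof.
split=> [[ws []]|[w1 [w2 [-> Lw1 [ws [-> Lws]]]]]]; last first.
  by exists ((c :: w1) :: ws).
elim: ws => [|[|c1 w1] ws IH] //=; first by move=> /IH{}IH [_ /IH].
by case=> <- -> [Lw1 Lws]; exists w1, (flatten ws); split=> //; exists ws.
Qed.

(** The new state [None] is the initial state and accepts the empty word; every final state may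
    restart with a first step from an old initial state. *)
Lemma regular_star L : regular L -> regular (star_lang L).
Proof.
case=> [N [I NL]].
pose enter c q := [exists i in I, @step N i c q].
pose N' := @Nfa (option (state N))
  (fun p c q => match p, q with
                | None, Some q => enter c q
                | Some p, Some q => step p c q || final p && enter c q
                | _, None => false end)
  (fun p => if p is Some p then final p else true).
have star0 : star_lang L [::] by exists [::].
have acc w : (forall q, @accepts N' (Some q) w <->
                cat_lang (accepts q) (star_lang L) w) /\
             (@accepts N' None w <-> star_lang L w).
  elim: w => [|c w [IH _]].
    split=> [q|]; rewrite accepts_nil /=; last by split.
    split=> [fq|]; first by exists [::], [::]; rewrite accepts_nil; split.
    case=> w1 [w2 [/esym/nilP]]; rewrite cat_nilp => /andP[/nilP-> _].
    by rewrite accepts_nil.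
  (* Starting from [None] and restarting from a final state share this first step into a new
     factor. *)
  have enterP : (exists2 m, enter c m & @accepts N' (Some m) w) <->
                star_lang L (c :: w).
    rewrite star_lang_cons; split.
      case=> m /existsP[i /andP[iI im]] /IH[w1 [w2 [-> mw1 Lw2]]].
      exists w1, w2; split=> //; apply/NL; exists i => //.
      by rewrite accepts_cons; apply/existsP; exists m; rewrite im.
    case=> w1 [w2 [def_w /NL[i iI]]]; rewrite accepts_cons.
    case/existsP=> m /andP[im mw1] Lw2; exists m.
      by apply/existsP; exists i; rewrite iI.
    by apply/IH; exists w1, w2.
  split=> [q|]; rewrite accepts_cons.
    split.
      case/existsP=> [[m|//]] /andP[/= /orP[qm|/andP[fq cm]] mw].
        case/IH: mw => w1 [w2 [-> mw1 Lw2]]; exists (c :: w1), w2; split=> //.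
        by rewrite accepts_cons; apply/existsP; exists m; rewrite qm.
      exists [::], (c :: w); split; rewrite ?accepts_nil //.
      by apply/enterP; exists m.
    case=> [[|c1 w1] [w2 [/= def_w qw1 Lw2]]].
      rewrite accepts_nil in qw1; move: Lw2; rewrite -def_w => /enterP[m cm mw].
      by apply/existsP; exists (Some m); rewrite mw /= qw1 cm orbT.
    case: def_w => -> def_w; move: qw1; rewrite accepts_cons.
    case/existsP=> m /andP[qm mw1]; apply/existsP; exists (Some m).
    by rewrite /= qm /=; apply/IH; exists w1, w2.
  rewrite -enterP; split=> [/existsP[[m|//] /andP[cm mw]]|[m cm mw]].
    by exists m.
  by apply/existsP; exists (Some m); rewrite mw andbT.
exists N', [set None] => w; split=> [Lw|[q]].
  by exists None; rewrite ?inE //; apply/(acc w).2.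
by rewrite inE => /eqP-> /(acc w).2.
Qed.

(** An iterated disjoint sum keeps all the languages. The conjunction is a [foldr] because [T] has
    no boolean equality, hence no membership in [s]. *)
Lemma common_nfa (T : Type) (L : T -> seq C -> Prop) (s : seq T) :
  (forall x, regular (L x)) ->
  exists N, foldr (fun x P => recognizes N (L x) /\ P) True s.
Proof.
move=> regL; elim: s => [|x s [N Ns]].
  by exists (@Nfa void (fun _ _ _ => false) (fun=> false)).
have [N1 N1x] := regL x; exists (sum_nfa N1 N); split.
  exact: recognizes_inl.
elim: s Ns => //= y s IH [Ny Ns]; split; last exact: IH.
exact: recognizes_inr.
Qed.

End Nfa.

Lemma reflang_regular (Sigma : finType) (g : regex Sigma) :
  regular (reflang g).
Proof.
elim: g => [|||g1 IH1 g2 IH2|g1 IH1 g2 IH2|g IH|x g IH] /=.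
- exact: regular_empty.
- exact: regular_eps.
- move=> a; pose is_a (b : refsym Sigma) := if b is Letter c then c == a else false.
  apply: (@regular_sym _ is_a).
  by rewrite /is_a => -[b|y|y]; split=> // [/eqP->|[->]].
- exact: regular_union.
- exact: regular_cat.
- exact: regular_star.
have regO : regular (fun r : seq (refsym Sigma) => r = [:: Open x]).
  apply: (@regular_sym _ (is_open x)) => -[b|y|y]; split=> //= [/eqP->|[->]] //.
have regC : regular (fun r : seq (refsym Sigma) => r = [:: Close x]).
  apply: (@regular_sym _ (is_close x)) => -[b|y|y]; split=> //= [/eqP->|[->]] //.
apply: regular_iff (regular_cat regO (regular_cat IH regC)) => r; split.
  case=> _ [_ [-> -> [r1 [_ [-> r1g ->]]]]].
  by exists r1; rewrite // cat1s cats1.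
case=> r1 -> r1g; exists [:: Open x], (rcons r1 (Close x)); split=> //.
by exists r1, [:: Close x]; rewrite cats1.
Qed.

(** * Factors of a word structure *)

Definition oseq (T : Type) (o : option T) : seq T :=
  if o is Some a then [:: a] else [::].

Section Segments.
Variables (Sigma : finType) (n : nat).
Implicit Type W : wstruct Sigma n.

(* Positions are numbers here, so that [n] stands for the end marker $; [seg W i j]
   collects the letters at the positions [i <= p < j]. *)
Definition nletter W (i : nat) : option Sigma := obind W (insub i).

Definition seg W (i j : nat) : seq Sigma := pmap (nletter W) (iota i (j - i)).

Lemma nletter_ord W (i : 'I_n) : nletter W i = W i.
Proof. by rewrite /nletter valK. Qed.

Lemma letter_atE W (x : 'I_n.+1) : letter_at W x = nletter W x.
Proof.
rewrite /letter_at; case: unliftP => [j|] ->.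
  by rewrite lift_max nletter_ord.
by rewrite /nletter insubF //= ltnn.
Qed.

Lemma segnn W i : seg W i i = [::].
Proof. by rewrite /seg subnn. Qed.

Lemma seg_cat W i j k : i <= j -> j <= k -> seg W i k = seg W i j ++ seg W j k.
Proof.
move=> ij jk; rewrite /seg -pmap_cat; congr pmap.
have -> : k - i = (j - i) + (k - j) by lia.
by rewrite iotaD subnKC.
Qed.

Lemma seg_succ W i : seg W i i.+1 = oseq (nletter W i).
Proof. by rewrite /seg subSnn /=; case: nletter. Qed.

Lemma seg_cons W i j : i < j ->
  seg W i j = oseq (nletter W i) ++ seg W i.+1 j.
Proof. by move=> ij; rewrite -seg_succ -seg_cat. Qed.

Lemma word_seg W : word W = seg W 0 n.
Proof.
rewrite /word /seg subn0 -val_enum_ord.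
by elim: (enum 'I_n) => //= i s IH; rewrite nletter_ord IH.
Qed.

Lemma seg_split W i j k : i <= j -> k <= size (seg W i j) ->
  exists m, [/\ i <= m, m <= j, seg W i m = take k (seg W i j)
              & seg W m j = drop k (seg W i j)].
Proof.
elim: j => [|j IH].
  rewrite leqn0 => /eqP->; rewrite segnn => k0; exists 0.
  by rewrite segnn.
rewrite leq_eqVlt => /orP[/eqP->|].
  by rewrite segnn => _; exists j.+1; rewrite segnn.
rewrite ltnS => ij; rewrite (@seg_cat _ i j j.+1) //.
have [kj _|jk] := leqP k (size (seg W i j)).
  have [m [im mj mt md]] := IH ij kj; exists m.
  rewrite (@seg_cat _ m j j.+1) // take_cat drop_cat mt md.
  move: kj; rewrite leq_eqVlt => /orP[/eqP->|->]; last by split=> //; apply: leqW.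
  rewrite ltnn subnn take0 drop0 drop_size take_size cats0.
  by split=> //; apply: leqW.
rewrite size_cat => kle; exists j.+1; split=> //; first exact: leqW.
  rewrite take_oversize ?(@seg_cat _ i j j.+1) // size_cat.
  by move: kle jk; rewrite seg_succ; case: nletter => [a|] /=; lia.
rewrite drop_oversize ?segnn // size_cat.
by move: kle jk; rewrite seg_succ; case: nletter => [a|] /=; lia.
Qed.

(** The first letter of a factor sits at a position [v] that is preceded by letterless positions
    only. *)
Lemma seg_uncons W i j a s : seg W i j = a :: s ->
  exists v, [/\ i <= v < j, nletter W v = Some a, seg W i v = [::]
              & seg W v.+1 j = s].
Proof.
elim: j s => [|j IH] s; first by rewrite /seg sub0n.
have [ij|ji] := leqP i j; last by rewrite /seg (eqP ji).
rewrite (@seg_cat _ i j j.+1) // seg_succ.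
case def_t: (seg W i j) => [|b t].
  case def_a: nletter => [b|] //= [<- <-].
  by exists j; rewrite ij ltnS leqnn segnn.
case=> def_b <-; rewrite def_b in def_t.
have [v [/andP[iv vj] va iv0 vjt]] := IH t def_t.
exists v; rewrite iv ltnW //; split=> //.
by rewrite (@seg_cat _ _ j) // seg_succ vjt.
Qed.

Lemma seg_letter W i v j : i <= v -> v < j -> seg W i v = [::] ->
  seg W i j = oseq (nletter W v) ++ seg W v.+1 j.
Proof. by move=> iv vj iv0; rewrite (seg_cat W iv (ltnW vj)) iv0 seg_cons. Qed.

Lemma posE W (x : 'I_n.+1) : pos W x = size (seg W 0 x.+1).
Proof.
rewrite /pos /seg subn0 size_pmap.
transitivity (count (fun i => nletter W i && (i <= x)) (iota 0 n.+1)).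
  rewrite cardE size_filter -val_enum_ord count_map enumT.
  by apply: eq_count => y; rewrite !inE /= letter_atE.
have := ltn_ord x; move: (nat_of_ord x) => i lt_in.
(* The range is cut after [i]; the positions beyond it count for nothing. *)
have {1}-> : n.+1 = i.+1 + (n.+1 - i.+1) by rewrite subnKC.
rewrite iotaD count_cat add0n addnC.
rewrite (@eq_in_count _ _ pred0 (iota i.+1 _)) ?count_pred0; last first.
  by move=> j; rewrite mem_iota [j <= i]leqNgt => /andP[-> _]; rewrite andbF.
rewrite add0n; apply: eq_in_count => j; rewrite mem_iota /= add0n ltnS => ->.
by rewrite andbT.
Qed.

(* The elements that can represent an endpoint of a span. *)
Definition markable W (x : 'I_n.+1) : bool := (x == ord_max) || letter_at W x.

(** Both kinds of endpoints obey one formula: a letter-carrying [x] counts itself in [pos], and the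
    letters before $ are the whole word. *)
Lemma marksE W (x : 'I_n.+1) p :
  marks W x p = markable W x && (p == (size (seg W 0 x)).+1).
Proof.
rewrite /marks /markable; case: eqP => [->|_] /=; first by rewrite word_seg.
rewrite letter_atE; case def_a: (nletter W x) => [a|] //=.
by rewrite posE (@seg_cat _ 0 x x.+1) // seg_succ def_a size_cat addn1.
Qed.

(** If [y < x], then [y] is not $ and carries a letter, which is counted before [x] but not before
    [y]. Thus the order of elements can be read off from numbers of letters. *)
Lemma markable_leq W (x : nat) (y : 'I_n.+1) : x <= n -> markable W y ->
  (x <= y) = (size (seg W 0 x) <= size (seg W 0 y)).
Proof.
move=> le_xn yM; apply/idP/idP=> [xy|].
  by rewrite (@seg_cat _ 0 x y) // size_cat leq_addr.
apply: contraTT; rewrite -!ltnNge => yx.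
rewrite (seg_cat W (leq0n y) (ltnW yx)) (seg_cons W yx) -letter_atE.
case/orP: yM => [/eqP def_y|]; first by move: yx; rewrite def_y ltnNge le_xn.
by case: letter_at => //= a _; rewrite size_cat /= addnS ltnS leq_addr.
Qed.

(** The last endpoint is represented by $; any other one by the first letter after a prefix of
    [p - 1] letters. *)
Lemma marks_ex W p : 0 < p <= (size (word W)).+1 ->
  exists x : 'I_n.+1, marks W x p.
Proof.
case: p => // p; rewrite word_seg /= ltnS leq_eqVlt => /orP[/eqP->|ltp].
  by exists ord_max; rewrite marksE /markable !eqxx.
have [m [_ mn mt md]] := seg_split (leq0n n) (ltnW ltp).
case def_s: (seg W m n) => [|a s].
  by move/eqP: def_s; rewrite md -size_eq0 size_drop subn_eq0 leqNgt ltp.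
have [v [/andP[mv vn] va mv0 _]] := seg_uncons def_s.
exists (inord v); rewrite marksE /markable letter_atE inordK 1?ltnW // va orbT.
by rewrite (seg_cat W (leq0n m) mv) mt mv0 cats0 size_take ltp eqxx.
Qed.

Lemma factor_seg W (x y : nat) : x <= y -> y <= n ->
  factor (word W) ((size (seg W 0 x)).+1, (size (seg W 0 y)).+1) = seg W x y.
Proof.
move=> xy yn; rewrite /factor word_seg /= (@seg_cat _ 0 y n) //.
by rewrite take_size_cat // (@seg_cat _ 0 x y) // drop_size_cat.
Qed.

Lemma nletter_apply W o (u : 'I_n) i :
  nletter (apply_op W o u) i = if i == u then op_letter o else nletter W i.
Proof.
rewrite /nletter; case: insubP => [j lt_in <-|] /=; first by rewrite ffunE.
by case: eqP => // ->; rewrite ltn_ord.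
Qed.

Lemma seg_apply_out W o (u : 'I_n) i j : (j <= u) || (u < i) ->
  seg (apply_op W o u) i j = seg W i j.
Proof.
move=> out_u; apply: eq_in_pmap => k; rewrite mem_iota nletter_apply.
by case: eqP => // ->; lia.
Qed.

Lemma seg_apply_in W o (u : 'I_n) i j : i <= u < j ->
  seg (apply_op W o u) i j = seg W i u ++ oseq (op_letter o) ++ seg W u.+1 j.
Proof.
case/andP=> iu uj; rewrite (seg_cat _ iu (ltnW uj)) (seg_cons _ uj).
by rewrite nletter_apply eqxx !seg_apply_out // ?leqnn ?ltnS ?leqnn ?orbT.
Qed.

End Segments.

(** * Guarded conjunctive queries *)

Section Base.
Variables (Sigma : finType) (N : nfa (refsym Sigma)).

(* [OneTop x y] says that x or y is $: guarded, it is the truth table of the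
   disjunction of two guards. *)
Inductive base :=
| Le | Succ | First | OneTop
| Let of Sigma
| Run of state N & state N
| Fac.

Definition base_code (R : base) :
    bool * bool + (unit + (Sigma + state N * state N)) :=
  match R with
  | Le => inl (false, false)
  | Succ => inl (false, true)
  | First => inl (true, false)
  | OneTop => inl (true, true)
  | Fac => inr (inl tt)
  | Let a => inr (inr (inl a))
  | Run p q => inr (inr (inr (p, q)))
  end.

Definition base_decode
    (c : bool * bool + (unit + (Sigma + state N * state N))) : base :=
  match c with
  | inl (false, false) => Le
  | inl (false, true) => Succ
  | inl (true, false) => First
  | inl (true, true) => OneTop
  | inr (inl _) => Fac
  | inr (inr (inl a)) => Let a
  | inr (inr (inr (p, q))) => Run p q
  end.

Lemma base_codeK : cancel base_code base_decode.
Proof. by case. Qed.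

HB.instance Definition _ := Finite.copy base (can_type base_codeK).

Definition ar (R : base) : nat :=
  match R with First | Let _ => 1 | Fac => 4 | _ => 2 end.

(** [seg] is empty on reversed endpoints; the tests [x <= y] keep these from passing for empty
    factors. *)
Definition base_sem n (W : wstruct Sigma n) (R : base) (t : seq 'I_n.+1) :
    bool :=
  match R, t with
  | Le, [:: x; y] => x <= y
  | Succ, [:: x; y] => y == x.+1 :> nat
  | First, [:: x] => x == 0 :> nat
  | OneTop, [:: x; y] => (x == ord_max) || (y == ord_max)
  | Let a, [:: x] => letter_at W x == Some a
  | Run p q, [:: x; y] =>
      (x <= y) && run p [seq Letter a | a <- seg W x y] q
  | Fac, [:: x; y; x'; y'] =>
      [&& x <= y, x' <= y' & seg W x y == seg W x' y']
  | _, _ => false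
  end.

(* [AUpd] is the updated element and [AEnd] is $. *)
Inductive arg (X : Type) := AVar of X | AUpd | AEnd.
Arguments AUpd {X}.
Arguments AEnd {X}.

Definition aval (X : Type) n (u : 'I_n) (e : X -> 'I_n.+1) (a : arg X) :
    'I_n.+1 :=
  match a with AVar x => e x | AUpd => elt u | AEnd => ord_max end.

Definition abind (X Y : Type) (f : X -> arg Y) (a : arg X) : arg Y :=
  match a with AVar x => f x | AUpd => AUpd | AEnd => AEnd end.

Lemma aval_bind (X Y : Type) n (u : 'I_n) (e : Y -> 'I_n.+1) (f : X -> arg Y) a :
  aval u e (abind f a) = aval u (fun x => aval u e (f x)) a.
Proof. by case: a. Qed.

Lemma eq_aval (X : Type) n (u : 'I_n) (e1 e2 : X -> 'I_n.+1) :
  e1 =1 e2 -> aval u e1 =1 aval u e2.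
Proof. by move=> e12 [x||] /=. Qed.

(* The first argument of an atom is its guard. *)
Definition atom (X : Type) : Type :=
  {R : base & (arg X * (ar R).-tuple (arg X))%type}.

Definition holds (X : Type) n (W : wstruct Sigma n) (u : 'I_n)
    (e : X -> 'I_n.+1) (A : atom X) : bool :=
  (aval u e (tagged A).1 != ord_max)
  || base_sem W (tag A) [seq aval u e a | a <- (tagged A).2].

Definition sub_atom (X Y : Type) (f : X -> arg Y) (A : atom X) : atom Y :=
  Tagged (fun R => (arg Y * (ar R).-tuple (arg Y))%type)
    (abind f (tagged A).1, map_tuple (abind f) (tagged A).2).

Lemma holds_sub (X Y : Type) n (W : wstruct Sigma n) u (e : Y -> 'I_n.+1)
    (f : X -> arg Y) (A : atom X) :
  holds W u e (sub_atom f A) = holds W u (fun x => aval u e (f x)) A.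
Proof.
rewrite /holds /= aval_bind -map_comp; congr (_ || base_sem _ _ _).
by apply: eq_map => a /=; rewrite aval_bind.
Qed.

Lemma eq_holds (X : Type) n (W : wstruct Sigma n) u (e1 e2 : X -> 'I_n.+1) :
  e1 =1 e2 -> holds W u e1 =1 holds W u e2.
Proof.
move=> e12 A; rewrite /holds (eq_aval _ e12); congr (_ || base_sem _ _ _).
exact/eq_map/eq_aval.
Qed.

(** The structure is the one before the update and the element is the updated one; a query speaks of
    the new word through [apply_op]. *)
Definition query (V : Type) : Type :=
  forall n, wstruct Sigma n -> 'I_n -> (V -> 'I_n.+1) -> Prop.

(* [inl None] is the guard, [inr z] an existentially quantified variable. *)
Definition genv (V B : Type) n (d : 'I_n.+1) (e : V -> 'I_n.+1)
    (b : B -> 'I_n.+1) (x : option V + B) : 'I_n.+1 :=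
  match x with inl None => d | inl (Some v) => e v | inr z => b z end.

(* [Q], guarded, is a conjunctive query over the guarded old relations; [l] lists
   its atoms. *)
Definition gdef (V : Type) (Q : query V) : Prop :=
  exists (B : finType) (l : seq (atom (option V + B))),
  forall n (W : wstruct Sigma n) u e d,
    (d != ord_max \/ Q n W u e) <->
    exists b, all (holds W u (genv d e b)) l.

Lemma all_sub (X Y : Type) n (W : wstruct Sigma n) u (e : Y -> 'I_n.+1)
    (f : X -> arg Y) (e' : X -> 'I_n.+1) l :
  (forall x, aval u e (f x) = e' x) ->
  all (holds W u e) (map (sub_atom f) l) = all (holds W u e') l.
Proof.
move=> ee'; rewrite all_map; apply: eq_all => A /=.
by rewrite holds_sub (eq_holds _ _ ee').
Qed.

Lemma gdef_iff (V : Type) (Q1 Q2 : query V) :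
  (forall n W u e, Q1 n W u e <-> Q2 n W u e) -> gdef Q1 -> gdef Q2.
Proof.
move=> Q12 [B [l Bl]]; exists B, l => n W u e d.
by rewrite -Bl Q12.
Qed.

Lemma gdef_base (V : Type) (R : base) (ts : (ar R).-tuple (arg V)) :
  gdef (fun n W u e => base_sem W R [seq aval u e a | a <- ts]).
Proof.
pose f v : arg (option V + void) := AVar (inl (Some v)).
exists void, [:: Tagged (fun R => (arg _ * (ar R).-tuple (arg _))%type)
                 (AVar (inl None), map_tuple (abind f) ts)].
move=> n W u e d; rewrite /holds /=.
have evE b : [seq aval u (genv d e b) a | a <- map (abind f) ts] =
              [seq aval u e a | a <- ts].
  by rewrite -map_comp; apply: eq_map => -[].
split=> [dQ|[b]]; last by rewrite andbT evE => /orP.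
have b (z : void) : 'I_n.+1 by case: z.
by exists b; rewrite andbT evE; apply/orP.
Qed.

Lemma gdef_true (V : Type) (Q : query V) :
  (forall n W u e, Q n W u e) -> gdef Q.
Proof.
move=> QT; exists void, [::] => n W u e d.
by split=> [_|_]; [exists (fun=> ord_max)|right].
Qed.

(** Disjunction with the guard distributes over conjunction, so both lists of atoms keep the same
    guard and only their quantified variables are separated. *)
Lemma gdef_and (V : Type) (Q1 Q2 : query V) : gdef Q1 -> gdef Q2 ->
  gdef (fun n W u e => Q1 n W u e /\ Q2 n W u e).
Proof.
case=> [B1 [l1 Bl1]] [B2 [l2 Bl2]].
pose f1 (x : option V + B1) : arg (option V + (B1 + B2)) :=
  AVar (match x with inl v => inl v | inr z => inr (inl z) end).
pose f2 (x : option V + B2) : arg (option V + (B1 + B2)) :=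
  AVar (match x with inl v => inl v | inr z => inr (inr z) end).
exists (B1 + B2)%type, (map (sub_atom f1) l1 ++ map (sub_atom f2) l2).
move=> n W u e d.
have f1E b : all (holds W u (genv d e b)) (map (sub_atom f1) l1) =
             all (holds W u (genv d e (b \o inl))) l1.
  by apply: all_sub => -[[v|]|z].
have f2E b : all (holds W u (genv d e b)) (map (sub_atom f2) l2) =
             all (holds W u (genv d e (b \o inr))) l2.
  by apply: all_sub => -[[v|]|z].
split=> [dQ|[b]].
  have /Bl1[b1 b1P] : d != ord_max \/ Q1 n W u e by case: dQ => [|[]]; auto.
  have /Bl2[b2 b2P] : d != ord_max \/ Q2 n W u e by case: dQ => [|[]]; auto.
  exists (fun z => match z with inl z => b1 z | inr z => b2 z end).
  by rewrite all_cat f1E f2E; apply/andP.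
rewrite all_cat f1E f2E => /andP[b1P b2P].
have /Bl1[|Q1t] : exists b, all (holds W u (genv d e b)) l1 by exists (b \o inl).
  by left.
have /Bl2[|Q2t] : exists b, all (holds W u (genv d e b)) l2 by exists (b \o inr).
  by left.
by right.
Qed.

Lemma gdef_or (V : Type) (Q1 Q2 : query V) : gdef Q1 -> gdef Q2 ->
  gdef (fun n W u e => Q1 n W u e \/ Q2 n W u e).
Proof.
case=> [B1 [l1 Bl1]] [B2 [l2 Bl2]].
pose B := (bool + (B1 + B2))%type.
(* The two quantified guards of the disjuncts, indexed by [true] and [false]. *)
pose g (c : bool) : arg (option V + B) := AVar (inr (inl c)).
pose f1 (x : option V + B1) : arg (option V + B) :=
  match x with inl None => g true | inl (Some v) => AVar (inl (Some v))
             | inr z => AVar (inr (inr (inl z))) end.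
pose f2 (x : option V + B2) : arg (option V + B) :=
  match x with inl None => g false | inl (Some v) => AVar (inl (Some v))
             | inr z => AVar (inr (inr (inr z))) end.
pose A : atom (option V + B) :=
  Tagged (fun R => (arg _ * (ar R).-tuple (arg _))%type)
    (AVar (inl None), [tuple g true; g false] : (ar OneTop).-tuple _).
exists B, (A :: map (sub_atom f1) l1 ++ map (sub_atom f2) l2).
move=> n W u e d; pose D := 'I_n.+1.
have f1E b : all (holds W u (genv d e b)) (map (sub_atom f1) l1) =
             all (holds W u (genv (b (inl true) : D) e (b \o inr \o inl))) l1.
  by apply: all_sub => -[[v|]|z].
have f2E b : all (holds W u (genv d e b)) (map (sub_atom f2) l2) =
             all (holds W u (genv (b (inl false) : D) e (b \o inr \o inr))) l2.
  by apply: all_sub => -[[v|]|z].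
have AE b : holds W u (genv d e b) A =
    [|| d != ord_max, b (inl true) == ord_max | b (inl false) == ord_max] by [].
have u_top : elt u != ord_max by rewrite eq_sym neq_lift.
split=> [dQ|[b]].
  (* The disjunct that holds gets the guard $; the updated element, which differs from $, switches
     the other one off. *)
  have [d1 [d2 [d12 dQ1 dQ2]]] : exists d1 d2 : D,
    [/\ [|| d != ord_max, d1 == ord_max | d2 == ord_max],
        d1 != ord_max \/ Q1 n W u e & d2 != ord_max \/ Q2 n W u e].
    case: dQ => [dT|[Q1t|Q2t]].
    - by exists (elt u), (elt u); rewrite dT; split=> //; left.
    - by exists ord_max, (elt u); rewrite eqxx !orbT; split; [|right|left].
    - by exists (elt u), ord_max; rewrite eqxx !orbT; split; [|left|right].
  case/Bl1: dQ1 => b1 b1P; case/Bl2: dQ2 => b2 b2P.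
  exists (fun z => match z with
                   | inl c => if c then d1 else d2
                   | inr (inl z) => b1 z
                   | inr (inr z) => b2 z end).
  by rewrite [all _ _]/= all_cat AE f1E f2E d12 b1P.
rewrite [all _ _]/= all_cat AE f1E f2E => /and3P[d12 b1P b2P].
have dQ1 : b (inl true) != ord_max \/ Q1 n W u e by apply/Bl1; eexists; exact: b1P.
have dQ2 : b (inl false) != ord_max \/ Q2 n W u e by apply/Bl2; eexists; exact: b2P.
case/or3P: d12 => [|bT|bF]; first by left.
  by case: dQ1 => [|Q1t]; rewrite ?bT //; right; left.
by case: dQ2 => [|Q2t]; rewrite ?bF //; right; right.
Qed.

(** Substitution and quantification in one: [f] sends each variable of [Q] to a free variable, a
    quantified one, or a constant. *)
Lemma gdef_ex (V V' : Type) (F : finType) (f : V -> arg (V' + F)) (Q : query V) :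
  gdef Q ->
  gdef (fun n W u (e : V' -> 'I_n.+1) => exists b : F -> 'I_n.+1,
    Q n W u (fun v => aval u (fun x => match x with inl v => e v | inr z => b z end)
                        (f v))).
Proof.
case=> B [l Bl].
pose h (x : V' + F) : option V' + (F + B) :=
  match x with inl v => inl (Some v) | inr z => inr (inl z) end.
pose g (x : option V + B) : arg (option V' + (F + B)) :=
  match x with inl None => AVar (inl None)
             | inl (Some v) => abind (fun x => AVar (h x)) (f v)
             | inr z => AVar (inr (inr z)) end.
exists (F + B)%type, (map (sub_atom g) l) => n W u e d.
pose ee (b : F + B -> 'I_n.+1) v := aval u (fun x => match x with inl v => e v
                                  | inr z => b (inl z) end) (f v).
have gE b : all (holds W u (genv d e b)) (map (sub_atom g) l) =
            all (holds W u (genv d (ee b) (b \o inr))) l.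
  apply: all_sub => -[[v|]|z] //=.
  by rewrite /ee aval_bind; apply: eq_aval => -[].
split=> [dQ|[b]].
  have [b /Bl[b' b'P]] : exists b, d != ord_max \/
      Q n W u (fun v => aval u (fun x => match x with inl v => e v | inr z => b z end)
                        (f v)).
    (* Under a guard other than $ any witness will do. *)
    by case: dQ => [dT|[b Qb]]; [exists (fun=> d); left|exists b; right].
  exists (fun z => match z with inl z => b z | inr z => b' z end).
  by rewrite gE.
rewrite gE => bP; have /Bl[|Qt] : exists b', all (holds W u (genv d (ee b) b')) l.
- by exists (b \o inr).
- by left.
- by right; exists (b \o inl).
Qed.

End Base.

(** * From guarded queries to dynamic programs *)

Section Prenex.
Variables (Sigma : finType) (A : Type) (rar : A -> nat).

Fixpoint exn (m k : nat) : fo Sigma rar (m + k) -> fo Sigma rar k :=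
  if m is m'.+1 then fun f => exn (FEx (f : fo Sigma rar (m' + k).+1))
  else fun f => f.

Lemma is_cq_conj k (f : fo Sigma rar k) : is_conj f -> is_cq f.
Proof. by case: f. Qed.

Lemma is_cq_exn m k (f : fo Sigma rar (m + k)) : is_cq f -> is_cq (exn f).
Proof. by elim: m f => //= m IH f fcq; apply: IH. Qed.

Lemma sat_exn n (W : wstruct Sigma n) (S : interp rar n) m k
    (f : fo Sigma rar (m + k)) (e : k.-tuple 'I_n.+1) :
  sat W S (exn f) e <-> exists s : m.-tuple 'I_n.+1, sat W S f (cat_tuple s e).
Proof.
elim: m f => [|m IH] f /=.
  split=> [fe|[s]]; last by rewrite (tuple0 s); congr (sat _ _ _ _); apply: val_inj.
  by exists [tuple]; move: fe; congr (sat _ _ _ _); apply: val_inj.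
rewrite IH /=; split=> [[s /existsP[d fs]]|[s fs]].
  exists (cons_tuple d s); move: fs; congr (sat _ _ _ _); exact: val_inj.
exists (behead_tuple s); apply/existsP; exists (thead s); move: fs.
by congr (sat _ _ _ _); apply: val_inj; case: s => [[|d s]].
Qed.

Definition conjn k (s : seq (fo Sigma rar k)) : fo Sigma rar k :=
  foldr (@FAnd _ _ _ k) (FEq _ _ End End) s.

Lemma sat_conjn n (W : wstruct Sigma n) (S : interp rar n) k
    (s : seq (fo Sigma rar k)) e :
  sat W S (conjn s) e = all (fun f => sat W S f e) s.
Proof. by elim: s => /= [|f s ->]; rewrite ?eqxx. Qed.

Lemma is_conj_conjn k (s : seq (fo Sigma rar k)) :
  is_conj (conjn s) = all (@is_conj _ _ _ k) s.
Proof. by elim: s => //= f s ->. Qed.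

End Prenex.

(** * Translation of guarded queries into formulas, and the initial relations *)

Section Compile.
Variables (Sigma : finType) (N : nfa (refsym Sigma)) (k : nat).

(** [None] is the output relation, stored without a guard; the stored base relations have the guard
    as an additional first component. *)
Definition aux_ar (R : option (base N)) : nat :=
  if R is Some R then (ar R).+1 else k.

Definition guarded n (W : wstruct Sigma n) (S : interp aux_ar n) : Prop :=
  forall (R : base N) (t : (ar R).+1.-tuple 'I_n.+1),
    (t \in S (Some R)) = (thead t != ord_max) || base_sem W R (behead t).

Section Atoms.
Variables (X : Type) (m : nat) (f : X -> term m) (up : term m).

Definition arg_term (a : arg X) : term m :=
  match a with AVar x => f x | AUpd => up | AEnd => End end.

Definition atom_fo (a : atom N X) : fo Sigma aux_ar m :=
  @FRel Sigma (option (base N)) aux_ar m (Some (tag a))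
    (cons_tuple (arg_term (tagged a).1) (map_tuple arg_term (tagged a).2)).

Lemma sat_atom_fo n (W W' : wstruct Sigma n) (S : interp aux_ar n) u
    (e : m.-tuple 'I_n.+1) (a : atom N X) :
  guarded W S -> eval e up = elt u ->
  sat W' S (atom_fo a) e = holds W u (fun x => eval e (f x)) a.
Proof.
move=> WS upu; rewrite /= WS /holds /thead (tnth_nth ord_max) /=.
have argE b : eval e (arg_term b) = aval u (fun x => eval e (f x)) b by case: b.
by rewrite argE -map_comp (eq_map (g := aval u (fun x => eval e (f x)))).
Qed.

End Atoms.

(** Apart from a trivial equality the formula has only atoms over auxiliary relations. It is
    therefore evaluated on the new structure [W'] but describes the old structure [W], letters
    included. *)
Lemma compile_cq (V : Type) (Q : query Sigma V) m (f : option V -> term m)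
    (up : term m) : gdef N Q ->
  exists2 phi : fo Sigma aux_ar m, is_cq phi &
    forall n (W W' : wstruct Sigma n) (S : interp aux_ar n) u (e : m.-tuple _),
      guarded W S -> eval e up = elt u ->
      sat W' S phi e <->
      eval e (f None) != ord_max \/ Q n W u (fun v => eval e (f (Some v))).
Proof.
case=> B [l Bl].
(* The quantified variables, enumerated from [B], take the first [#|B|] de Bruijn indices. *)
pose shift (t : term m) : term (#|B| + m) :=
  match t with Var i => Var (rshift #|B| i) | End => End end.
pose g (x : option V + B) : term (#|B| + m) :=
  match x with inl v => shift (f v) | inr z => Var (lshift m (enum_rank z)) end.
exists (exn (conjn (map (atom_fo g (shift up)) l))).
  apply/is_cq_exn/is_cq_conj; rewrite is_conj_conjn all_map.
  by elim: l {Bl}.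
move=> n W W' S u e WS upu.
have shiftE (s : #|B|.-tuple 'I_n.+1) t : eval (cat_tuple s e) (shift t) = eval e t.
  by case: t => //= i; rewrite tnth_rshift.
have gE (s : #|B|.-tuple 'I_n.+1) x : eval (cat_tuple s e) (g x) =
    genv (eval e (f None)) (fun v => eval e (f (Some v)))
         (fun z => tnth s (enum_rank z)) x.
  by case: x => [[v|]|z] /=; rewrite ?shiftE // tnth_lshift.
have satE (s : #|B|.-tuple 'I_n.+1) :
    sat W' S (conjn (map (atom_fo g (shift up)) l)) (cat_tuple s e) =
    all (holds W u (genv (eval e (f None)) (fun v => eval e (f (Some v)))
         (fun z => tnth s (enum_rank z)))) l.
  rewrite sat_conjn all_map; apply: eq_all => a.
  rewrite -[LHS]/(sat W' S (atom_fo g (shift up) a) (cat_tuple s e)).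
  rewrite (@sat_atom_fo _ _ _ _ n W W' S u) ?shiftE //.
  by apply: eq_holds => x; rewrite gE.
rewrite Bl sat_exn; split=> [[s]|[b bP]].
  by rewrite satE => sP; exists (fun z => tnth s (enum_rank z)).
exists [tuple b (enum_val i) | i < #|B|]; rewrite satE.
rewrite (eq_all (a2 := holds W u (genv (eval e (f None))
  (fun v => eval e (f (Some v))) b))) // => a.
by apply: eq_holds => -[[v|]|z] //=; rewrite tnth_mktuple enum_rankK.
Qed.

(** Coding updates by the finite type [option Sigma] allows a finite choice of update formulas. *)
Definition op_of (oa : option Sigma) : update_op Sigma :=
  if oa is Some a then Ins a else Reset.

Lemma op_ofK (o : update_op Sigma) : op_of (op_letter o) = o.
Proof. by case: o. Qed.

(** All factors of the empty structure are empty, so [Run p q] amounts to [p = q] and [Fac] to its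
    two order tests. Index 0 is the guard and the arguments start at 1, hence at 2 below a
    quantifier. *)
Definition base_init (R : base N) : fo Sigma (of_void nat) (ar R).+1 :=
  let x i := @Var (ar R).+1 (inord i) in
  FOr (FNot (FEq _ _ (x 0) End))
    (match R with
     | Le => FOr (FLt _ _ (x 1) (x 2)) (FEq _ _ (x 1) (x 2))
     | Succ =>
         FAnd (FLt _ _ (x 1) (x 2))
           (FNot (FEx (FAnd (FLt _ _ (Var (inord 2)) (Var ord0))
                            (FLt _ _ (Var ord0) (Var (inord 3))))))
     | First => FNot (FEx (FLt _ _ (Var ord0) (Var (inord 2))))
     | OneTop => FOr (FEq _ _ (x 1) End) (FEq _ _ (x 2) End)
     | Let _ => FNot (FEq _ _ End End)
     | Run p q =>
         if p == q then FOr (FLt _ _ (x 1) (x 2)) (FEq _ _ (x 1) (x 2))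
         else FNot (FEq _ _ End End)
     | Fac => FAnd (FOr (FLt _ _ (x 1) (x 2)) (FEq _ _ (x 1) (x 2)))
                   (FOr (FLt _ _ (x 3) (x 4)) (FEq _ _ (x 3) (x 4)))
     end).

Lemma eval_inord n m (e : m.+1.-tuple 'I_n.+1) i : i <= m ->
  eval e (Var (inord i)) = nth ord_max e i.
Proof. by move=> im; rewrite /= (tnth_nth ord_max) inordK. Qed.

Lemma seg_empty n i j : seg (empty_wstruct Sigma n) i j = [::].
Proof.
rewrite /seg; elim: (iota _ _) => //= x s ->.
by rewrite /nletter; case: insub => //= y; rewrite ffunE.
Qed.

Lemma leE n (x y : 'I_n.+1) : (x < y) || (x == y) = (x <= y).
Proof. by rewrite orbC [RHS]leq_eqVlt. Qed.

Lemma sat_base_init n (R : base N) (t : (ar R).+1.-tuple 'I_n.+1) :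
  sat (empty_wstruct Sigma n) (fun v : void => of_void _ v) (base_init R) t =
  (thead t != ord_max) || base_sem (empty_wstruct Sigma n) R (behead t).
Proof.
rewrite /base_init [sat _ _ _ _]/= -[tnth t (inord 0)]/(eval t (Var (inord 0))).
rewrite eval_inord // /thead (tnth_nth ord_max t) /=; congr (_ || _).
case: R t => [||||a|p q|] /= [[|d [|x [|y [|x' [|y' [|z s]]]]]] //= st].
- by rewrite !(tnth_nth ord_max) /= !inordK // leE.
- rewrite !(tnth_nth ord_max) /= !inordK //.
  apply/andP/eqP=> [[xy /negP noz]|xy].
    apply/eqP; rewrite eqn_leq xy andbT leqNgt; apply/negP => xy'.
    (* Otherwise [x + 1] would lie strictly between [x] and [y]. *)
    case: noz; apply/existsP; exists (Ordinal (ltn_trans xy' (ltn_ord y))).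
    by rewrite !(tnth_nth ord_max) /= !inordK //= ltnSn.
  rewrite xy; split=> //; apply/negP => /existsP[z].
  by rewrite !(tnth_nth ord_max) /= !inordK //= xy ltnS => /andP[]; case: ltngtP.
- apply/negP/eqP=> [noz|x0 /existsP[z]]; last first.
    by rewrite !(tnth_nth ord_max) /= !inordK //= x0.
  apply/eqP; rewrite -leqn0 leqNgt; apply/negP => x0.
  case: noz; apply/existsP; exists ord0.
  by rewrite !(tnth_nth ord_max) /= !inordK.
- by rewrite !(tnth_nth ord_max) /= !inordK.
- by rewrite eqxx letter_atE /nletter; case: insub => // i; rewrite /= ffunE.
- rewrite seg_empty /=; case: (p =P q) => _ /=; last by rewrite eqxx andbF.
  by rewrite !(tnth_nth ord_max) /= !inordK // leE andbT.
- by rewrite !(tnth_nth ord_max) /= !inordK // !leE !seg_empty eqxx andbT.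
Qed.

End Compile.

(** * The dynamic program obtained from definable updates *)

Section Main.
Variables (Sigma : finType) (N : nfa (refsym Sigma)) (k : nat).
Variable Q : word_relation Sigma.

Hypothesis base_upd : forall o (R : base N),
  gdef N (fun n W u (e : 'I_(ar R) -> 'I_n.+1) =>
    base_sem (apply_op W o u) R [seq e i | i <- enum 'I_(ar R)]).

Hypothesis out_upd : forall o,
  gdef N (fun n W u (e : 'I_k -> 'I_n.+1) =>
    Q (apply_op W o u) [seq e i | i <- enum 'I_k]).

Hypothesis out_init : exists phi : fo Sigma (of_void nat) k,
  forall n (t : k.-tuple 'I_n.+1),
    sat (empty_wstruct Sigma n) (fun v : void => of_void _ v) phi t <->
    Q (empty_wstruct Sigma n) t.

Lemma dyncq_of_gdef : in_DynCQ k Q.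
Proof.
have [phi0 phi0P] := out_init.
(* The new value of each stored relation is specified from old relations in guarded form. *)
pose spec (x : option Sigma * option (base N))
    (phi : fo Sigma (@aux_ar _ N k) (@aux_ar _ N k x.2).+1) : Prop :=
  is_cq phi /\ forall n (W : wstruct Sigma n) S u t, guarded W S ->
    let W' := apply_op W (op_of x.1) u in
    sat W' S phi (cons_tuple (elt u) t) <->
    if x.2 is Some R then head ord_max t != ord_max \/ base_sem W' R (behead t)
    else Q W' t.
have /fin_all_exists[upd updP] : forall x, exists phi, spec x phi.
  case=> oa [R|].
    (* Variable 0 is the updated element, variable 1 the guard, and the arguments follow. *)
    pose f (v : option 'I_(ar R)) : term (ar R).+2 :=
      if v is Some i then Var (lift ord0 (lift ord0 i)) else Var (lift ord0 ord0).
    have [phi phi_cq phiP] := compile_cq k f (Var ord0) (base_upd (op_of oa) R).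
    exists phi; split=> // n W S u t WS /=.
    rewrite (phiP n W _ _ u) //= !(tnth_nth ord_max) /=.
    have -> // : [seq tnth (cons_tuple (elt u) t) (lift ord0 (lift ord0 i))
                   | i <- enum 'I_(ar R)] = behead t.
    rewrite -[RHS](map_tnth_enum (behead_tuple t)); apply: eq_map => i.
    by rewrite !(tnth_nth ord_max) /= nth_behead.
  (* Fixing the guard to $ removes it from the output query. *)
  pose f (v : option 'I_k) : term k.+1 :=
    if v is Some i then Var (lift ord0 i) else End.
  have [phi phi_cq phiP] := compile_cq k f (Var ord0) (out_upd (op_of oa)).
  exists phi; split=> // n W S u t WS /=.
  rewrite (phiP n W _ _ u) //= eqxx.
  have -> : [seq tnth (cons_tuple (elt u) t) (lift ord0 i) | i <- enum 'I_k] = t.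
    rewrite -[RHS](map_tnth_enum t); apply: eq_map => i.
    by rewrite !(tnth_nth ord_max).
  by split=> [[]|]; auto.
pose ini (R : option (base N)) : fo Sigma (of_void nat) (@aux_ar _ N k R) :=
  match R with Some R => base_init R | None => phi0 end.
pose p := @Dynprog Sigma (option (base N)) (@aux_ar _ N k) ini
  (fun o R => upd (op_letter o, R)) None.
exists p; split=> [o R|]; first exact: (updP (op_letter o, R)).1.
split=> // n W S.
(* The invariant: base relations are stored in guarded form, and the output relation is exactly
   [Q]. *)
suff inv : reachable W S -> guarded W (S : interp (@aux_ar _ N k) n) /\
    forall t, t \in (S : interp (@aux_ar _ N k) n) None <-> Q W t.
  by case/inv.
elim=> [|{}W {}S o u _ [WS _] _].
  split=> [R t|t]; last by rewrite inE; apply: phi0P.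
  by rewrite inE; apply: sat_base_init.
have stepP R t := (updP (op_letter o, R)).2 n W S u t WS.
split=> [R t|t]; rewrite inE; last first.
  by have /= := stepP None t; rewrite op_ofK.
have /= := stepP (Some R) t; rewrite op_ofK => RP.
have -> : thead t = head ord_max t by rewrite /thead (tnth_nth ord_max) nth0.
by apply/idP/orP => /RP.
Qed.

End Main.

(** * Maintaining runs and factor equality *)

(** The numerical value of [elt u] unfolds to [bump n u]. *)
Lemma bump_ord n (u : 'I_n) : bump n u = u.
Proof. by rewrite /bump leqNgt ltn_ord. Qed.

Section Closure.
Variables (Sigma : finType) (N : nfa (refsym Sigma)).

(** Atoms see only the values of an assignment, so a definable query respects pointwise equality; no
    functional extensionality is involved. *)
Lemma gdef_ext (V : Type) (Q : query Sigma V) n W u (e1 e2 : V -> 'I_n.+1) :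
  gdef N Q -> e1 =1 e2 -> Q n W u e1 -> Q n W u e2.
Proof.
case=> B [l Bl] e12 Q1.
have /Bl[b bP] : (ord_max : 'I_n.+1) != ord_max \/ Q n W u e1 by right.
have /Bl[|//] : exists b, all (holds W u (genv ord_max e2 b)) l; last by rewrite eqxx.
exists b; rewrite -(eq_all (a1 := holds W u (genv ord_max e1 b))) //.
by apply: eq_holds => -[[v|]|z] /=.
Qed.

Lemma gdef_subst (V V' : Type) (f : V -> arg V') (Q : query Sigma V) :
  gdef N Q -> gdef N (fun n W u e => Q n W u (fun v => aval u e (f v))).
Proof.
move=> Qdef.
pose g v : arg (V' + void) := abind (fun x => AVar (inl x)) (f v).
apply: gdef_iff (gdef_ex (F := void) g Qdef).
move=> n W u e; split=> [[b]|Qe].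
  by apply: gdef_ext => // v; rewrite aval_bind.
have b (z : void) : 'I_n.+1 by case: z.
by exists b; apply: gdef_ext Qe => // v; rewrite aval_bind.
Qed.

Definition ocons (V : Type) n (x : 'I_n.+1) (e : V -> 'I_n.+1) (o : option V) :=
  if o is Some v then e v else x.

Definition wk (V : Type) (a : arg V) : arg (option V) :=
  abind (fun v => AVar (Some v)) a.

Lemma aval_wk (V : Type) n (u : 'I_n) x (e : V -> 'I_n.+1) a :
  aval u (ocons x e) (wk a) = aval u e a.
Proof. by case: a. Qed.

Lemma gdef_ex1 (V : Type) (Q : query Sigma (option V)) : gdef N Q ->
  gdef N (fun n W u e => exists x, Q n W u (ocons x e)).
Proof.
move=> Qdef; pose f (o : option V) : arg (V + unit) :=
  AVar (if o is Some v then inl v else inr tt).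
apply: gdef_iff (gdef_ex (F := unit) f Qdef) => n W u e; split=> [[b]|[x]] Qe.
  by exists (b tt); apply: gdef_ext Qe => // -[].
by exists (fun=> x); apply: gdef_ext Qe => // -[].
Qed.

(** Falsity is expressed by making the updated element its own successor. *)
Lemma gdef_bool (V : Type) (b : bool) : gdef N (fun n W u (e : V -> 'I_n.+1) => b).
Proof.
case: b; first exact: gdef_true.
apply: gdef_iff (gdef_base (R := Succ N) [tuple AUpd V; AUpd V]) => n W u e /=.
by split=> // /eqP; lia.
Qed.

Lemma gdef_has (V : Type) (I : eqType) (s : seq I) (Q : I -> query Sigma V) :
  (forall i, gdef N (Q i)) ->
  gdef N (fun n W u e => exists2 i, i \in s & Q i n W u e).
Proof.
move=> Qdef; elim: s => [|i s IH].
  by apply: gdef_iff (gdef_bool V false) => n W u e; split=> // -[].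
apply: gdef_iff (gdef_or (Qdef i) IH) => n W u e; split.
  case=> [Qi|[j js Qj]]; first by exists i; rewrite ?mem_head.
  by exists j; rewrite // in_cons js orbT.
case=> j /predU1P[->|js] Qj; [by left|by right; exists j].
Qed.

Lemma gdef_all (V : Type) (I : eqType) (s : seq I) (Q : I -> query Sigma V) :
  (forall i, i \in s -> gdef N (Q i)) ->
  gdef N (fun n W u e => forall i, i \in s -> Q i n W u e).
Proof.
elim: s => [|i s IH] Qdef; first exact: gdef_true.
have sdef j : j \in s -> gdef N (Q j).
  by move=> js; apply: Qdef; rewrite in_cons js orbT.
apply: gdef_iff (gdef_and (Qdef i (mem_head _ _)) (IH sdef)) => n W u e.
split=> [[Qi Qs] j /predU1P[->|/Qs]|Qs] //.
by split=> [|j js]; apply: Qs; rewrite ?mem_head // in_cons js orbT.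
Qed.

Lemma gdef_exT (V : Type) (I : finType) (Q : I -> query Sigma V) :
  (forall i, gdef N (Q i)) -> gdef N (fun n W u e => exists i, Q i n W u e).
Proof.
move=> /(gdef_has (enum I)); apply: gdef_iff => n W u e.
by split=> [[i _]|[i Qi]]; exists i; rewrite ?mem_enum.
Qed.

Section Pieces.
Variable V : Type.
Implicit Types (a b : arg V).

Lemma gdef_le a b : gdef N (fun n W u e => aval u e a <= aval u e b).
Proof. exact: (gdef_base (R := Le N) [tuple a; b]). Qed.

Lemma gdef_succ a b :
  gdef N (fun n W u e => aval u e b == (aval u e a).+1 :> nat).
Proof. exact: (gdef_base (R := Succ N) [tuple a; b]). Qed.

Lemma gdef_letter c a : gdef N (fun n W u e => letter_at W (aval u e a) == Some c).
Proof. exact: (gdef_base (R := Let N c) [tuple a]). Qed.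

Lemma gdef_run (p q : state N) a b :
  gdef N (fun n W u e => base_sem W (Run p q) [:: aval u e a; aval u e b]).
Proof. exact: (gdef_base (R := Run p q) [tuple a; b]). Qed.

Lemma gdef_fac a b a' b' : gdef N (fun n W u e =>
  base_sem W (Fac N) [:: aval u e a; aval u e b; aval u e a'; aval u e b']).
Proof. exact: (gdef_base (R := Fac N) [tuple a; b; a'; b']). Qed.

Lemma gdef_eq a b : gdef N (fun n W u e => aval u e a = aval u e b).
Proof.
apply: gdef_iff (gdef_and (gdef_le a b) (gdef_le b a)) => n W u e.
by split=> [[ab ba]|->]; [apply/val_inj/eqP; rewrite eqn_leq ab|].
Qed.

End Pieces.

(** * Concatenations of old factors and single letters *)

Inductive piece (V : Type) := Int of arg V & arg V | Lit of Sigma.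
Arguments Lit {V}.

Section Values.
Variables (V : Type) (n : nat) (W : wstruct Sigma n) (u : 'I_n).
Variable e : V -> 'I_n.+1.

Definition pval (s : piece V) : seq Sigma :=
  match s with Int a b => seg W (aval u e a) (aval u e b) | Lit c => [:: c] end.

Definition pok (s : piece V) : bool :=
  if s is Int a b then aval u e a <= aval u e b else true.

Definition pvals (ss : seq (piece V)) : seq Sigma := flatten (map pval ss).

Definition peq (ss ts : seq (piece V)) : Prop :=
  [/\ all pok ss, all pok ts & pvals ss = pvals ts].

End Values.

Definition wkp (V : Type) (s : piece V) : piece (option V) :=
  match s with Int a b => Int (wk a) (wk b) | Lit c => Lit c end.

Lemma pvals_wk V n (W : wstruct Sigma n) u x (e : V -> 'I_n.+1) ss :
  pvals W u (ocons x e) (map (@wkp V) ss) = pvals W u e ss.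
Proof.
rewrite /pvals -map_comp; congr flatten; apply: eq_map.
by move=> -[a b|c] //=; rewrite !aval_wk.
Qed.

Lemma pok_wk V n (u : 'I_n) x (e : V -> 'I_n.+1) ss :
  all (pok u (ocons x e)) (map (@wkp V) ss) = all (pok u e) ss.
Proof.
by rewrite all_map; apply: eq_all => -[a b|c] //=; rewrite !aval_wk.
Qed.

Lemma peq_sym V n (W : wstruct Sigma n) u (e : V -> 'I_n.+1) ss ts :
  peq W u e ss ts <-> peq W u e ts ss.
Proof. by split=> -[]; split. Qed.

(* A solution of [a, b> s = [c, d> t cuts the longer of the two leading factors;
   this is the recursion behind [gdef_peq]. *)
Lemma int_prefix n (W : wstruct Sigma n) (a b c d : 'I_n.+1) s t :
  c <= d -> size (seg W a b) <= size (seg W c d) ->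
  seg W a b ++ s = seg W c d ++ t ->
  exists m : 'I_n.+1,
    [/\ c <= m, m <= d, seg W a b = seg W c m & s = seg W m d ++ t].
Proof.
move=> cd le_s eq_st; have [m [cm md mt mdr]] := seg_split cd le_s.
have mn : m < n.+1 by apply: leq_ltn_trans md (ltn_ord d).
exists (Ordinal mn); split=> //=; rewrite ?mt ?mdr.
  have := congr1 (take (size (seg W a b))) eq_st.
  by rewrite take_size_cat // takel_cat.
have := congr1 (drop (size (seg W a b))) eq_st.
rewrite drop_size_cat // drop_cat.
by case: ltngtP le_s => // -> _ ->; rewrite subnn drop0 drop_size.
Qed.

(** Comparison with the trivial factor at [a] lets [Fac] test for emptiness. *)
Lemma fac_empty n (W : wstruct Sigma n) (a b : 'I_n.+1) :
  base_sem W (Fac N) [:: a; b; a; a] = (a <= b) && (seg W a b == [::]).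
Proof. by rewrite /= leqnn segnn. Qed.

Lemma pvals_cons V n (W : wstruct Sigma n) u (e : V -> 'I_n.+1) s ss :
  pvals W u e (s :: ss) = pval W u e s ++ pvals W u e ss.
Proof. by []. Qed.

(** Each case removes a leading piece. Of two leading factors the shorter one equals a prefix of the
    other, cut at a quantified [m], and the rest of the longer one stays. Against a literal, a
    leading factor is either empty or starts with that letter. *)
Lemma gdef_peq (V : Type) (ss ts : seq (piece V)) :
  gdef N (fun n W u e => peq W u e ss ts).
Proof.
(* The induction is on the number of pieces, with [V] general because the quantified cut points
   become variables. *)
have [k] := ubnP (size ss + size ts); elim: k V ss ts => // k IH V ss ts.
have drop_int a b (rs rs' : seq (piece V)) : size rs + size rs' < k ->
    gdef N (fun n W u e =>
      base_sem W (Fac N) [:: aval u e a; aval u e b; aval u e a; aval u e a] /\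
      peq W u e rs rs').
  by move=> lt_k; apply: gdef_and (gdef_fac _ _ _ _) (IH _ _ _ lt_k).
have lit_int c a b (rs rs' : seq (piece V)) : (size rs + size rs').+1 < k ->
    gdef N (fun n W u e => peq W u e (Lit c :: rs) (Int a b :: rs')).
  move=> lt_k.
  have lt1 : size (Lit c :: rs) + size rs' < k by [].
  have lt2 : size (map (@wkp _) (map (@wkp V) rs)) +
      size (Int (AVar None) (wk (wk b)) :: map (@wkp _) (map (@wkp V) rs')) < k.
    by rewrite /= !size_map addnS.
  (* [Some None] is the position [v] of the first letter of the factor, and [None] its successor,
     where the rest of the factor starts. *)
  have v_def := gdef_and (gdef_letter c (AVar (Some None)))
    (gdef_and (gdef_succ (AVar (Some None)) (AVar None))
    (gdef_and (gdef_le (AVar None) (wk (wk b)))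
    (gdef_and (gdef_fac (wk (wk a)) (AVar (Some None)) (wk (wk a)) (wk (wk a)))
              (IH _ _ _ lt2)))).
  apply: gdef_iff (gdef_or (drop_int a b _ _ lt1) (gdef_ex1 (gdef_ex1 v_def))).
  move=> n W u e; rewrite fac_empty; split.
    case=> [[/andP[ab /eqP ab0] [ok1 ok2 eqv]]|].
      by split=> //=; rewrite ?ab // [RHS]pvals_cons /= ab0.
    case=> v [v' [/eqP vc [/eqP vv' [v'b [av]]]]].
    rewrite /= in vc vv' v'b *; rewrite fac_empty !aval_wk in av v'b *.
    case/andP: av => av /eqP av0 []; rewrite !pok_wk /= !pok_wk !aval_wk.
    move=> ok1 /andP[_ ok2]; rewrite pvals_cons /= !pvals_wk !aval_wk => eqv.
    have vb : v < aval u e b by rewrite -vv'.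
    split=> //=; first by rewrite ok2 andbT; apply: leq_trans av (ltnW vb).
    rewrite !pvals_cons /= (seg_letter av vb av0) -letter_atE vc /=.
    by rewrite -vv' eqv.
  case=> /= ok1 /andP[ab ok2]; rewrite !pvals_cons /=.
  case def_s: (seg W (aval u e a) (aval u e b)) => [|c' s].
    by move=> eqv; left; rewrite ab; split.
  case=> def_c eqv; right.
  have [v [/andP[av vb] vc av0 vs]] := seg_uncons def_s.
  have vn := leq_ltn_trans vb (ltn_ord (aval u e b)).
  exists (Ordinal (ltnW vn)), (Ordinal vn); rewrite /= !aval_wk.
  split; first by rewrite letter_atE /= vc def_c.
  do !split; rewrite ?av ?av0 ?segnn ?leqnn //= ?pok_wk //.
    by rewrite !aval_wk vb.
  by rewrite pvals_cons !pvals_wk /= !aval_wk eqv vs.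
have int_int a b c d (rs rs' : seq (piece V)) : (size rs + size rs').+1 < k ->
    gdef N (fun n W u e => exists m : 'I_n.+1,
      base_sem W (Fac N) [:: aval u e a; aval u e b; aval u e c; m] /\
      (m <= aval u e d /\ peq W u (ocons m e) (map (@wkp V) rs)
         (Int (AVar None) (wk d) :: map (@wkp V) rs'))).
  move=> lt_k.
  have lt1 : size (map (@wkp V) rs) +
      size (Int (AVar None) (wk d) :: map (@wkp V) rs') < k.
    by rewrite /= !size_map addnS.
  have m_def := gdef_and (gdef_fac (wk a) (wk b) (wk c) (AVar None))
    (gdef_and (gdef_le (AVar None) (wk d)) (IH _ _ _ lt1)).
  apply: gdef_iff (gdef_ex1 m_def) => n W u e.
  by split=> -[m H]; exists m; move: H; rewrite /= !aval_wk.
(* The query with the cut [m] captures the solutions whose left leading factor is not the longer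
   one; the symmetric query covers the others. *)
have int_intP a b c d (rs rs' : seq (piece V)) n (W : wstruct Sigma n) u e :
    (exists m : 'I_n.+1,
      base_sem W (Fac N) [:: aval u e a; aval u e b; aval u e c; m] /\
      (m <= aval u e d /\ peq W u (ocons m e) (map (@wkp V) rs)
         (Int (AVar None) (wk d) :: map (@wkp V) rs'))) <->
    peq W u e (Int a b :: rs) (Int c d :: rs') /\
    size (seg W (aval u e a) (aval u e b)) <=
    size (seg W (aval u e c) (aval u e d)).
  split.
    case=> m [/and3P[ab cm /eqP ab_cm] [md []]].
    rewrite !pok_wk pvals_cons !pvals_wk /= !pok_wk !aval_wk.
    move=> ok1 /andP[_ ok2] eqv; split; last first.
      by rewrite ab_cm (seg_cat W cm md) size_cat leq_addr.
    split=> /=; rewrite ?ab ?(leq_trans cm md) // !pvals_cons /= ab_cm.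
    by rewrite (seg_cat W cm md) eqv catA.
  case=> [[/= /andP[ab ok1] /andP[cd ok2]]]; rewrite !pvals_cons /=.
  move=> eqv le_s; have [m [cm md abm eqv']] := int_prefix cd le_s eqv.
  exists m; rewrite /= ab cm abm eqxx; do !split; rewrite //= ?pok_wk //.
    by rewrite !aval_wk md.
  by rewrite pvals_cons !pvals_wk /= aval_wk.
case: ss ts => [|[a b|c] ss] [|[a' b'|c'] ts] /=;
  rewrite ?addnS ?addSn ?addn0 ?add0n ltnS => lt_k.
- exact: gdef_true.
- apply: gdef_iff (drop_int a' b' [::] ts lt_k) => n W u e; rewrite fac_empty.
  split=> [[/andP[ab /eqP ab0] [ok1 ok2 eqv]]|[/= _ /andP[ab ok2]]].
    by split=> //=; rewrite ?ab // pvals_cons /= ab0.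
  rewrite pvals_cons /= => /esym/nilP; rewrite cat_nilp ab.
  by move=> /andP[/nilP-> /nilP eqv]; split=> //; split=> //; rewrite eqv.
- by apply: gdef_iff (gdef_bool V false) => n W u e; split=> // -[].
- have lt1 : size ss + size (Nil (piece V)) < k by rewrite addn0.
  apply: gdef_iff (drop_int a b ss [::] lt1) => n W u e; rewrite fac_empty.
  split=> [[/andP[ab /eqP ab0] [ok1 ok2 eqv]]|[/= /andP[ab ok2] _]].
    by split=> //=; rewrite ?ab // pvals_cons /= ab0.
  rewrite pvals_cons /= => /nilP; rewrite cat_nilp ab.
  by move=> /andP[/nilP-> /nilP eqv]; split=> //; split=> //; rewrite eqv.
- have lt_k' : (size ts + size ss).+1 < k by rewrite addnC.
  have h := gdef_or (int_int a b a' b' ss ts lt_k) (int_int a' b' a b ts ss lt_k').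
  apply: gdef_iff h => n W u e.
  rewrite !int_intP; split=> [[[]|[/peq_sym]]|eqv] //.
  by case: (leqP (size (seg W (aval u e a) (aval u e b)))
                 (size (seg W (aval u e a') (aval u e b')))) => le_s;
    [left|right; split; [apply/peq_sym|apply: ltnW]].
- have lt_k' : (size ts + size ss).+1 < k by rewrite addnC.
  by apply: gdef_iff (lit_int c' a b ts ss lt_k') => n W u e; exact: peq_sym.
- by apply: gdef_iff (gdef_bool V false) => n W u e; split=> // -[].
- exact: lit_int.
- have lt1 : size ss + size ts < k by apply: ltnW.
  apply: gdef_iff (gdef_and (gdef_bool V (c == c')) (IH _ _ _ lt1)) => n W u e.
  split=> [[/eqP-> [ok1 ok2 eqv]]|[/= ok1 ok2]].
    by split; rewrite // !pvals_cons eqv.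
  by rewrite !pvals_cons /= => -[-> eqv]; rewrite eqxx.
Qed.

(** The state after each piece is guessed; this is a finite disjunction. *)
Lemma gdef_runs (V : Type) (ss : seq (piece V)) (p q : state N) :
  gdef N (fun n W u e =>
    all (pok u e) ss && run p [seq Letter a | a <- pvals W u e ss] q).
Proof.
elim: ss p => [|s ss IH] p; first exact: gdef_bool.
have sdef m : gdef N (fun n W u e =>
    pok u e s && run p [seq Letter a | a <- pval W u e s] m).
  by case: s => [a b|c]; [exact: gdef_run|exact: gdef_bool].
apply: gdef_iff (gdef_exT (fun m => gdef_and (sdef m) (IH m))) => n W u e.
rewrite pvals_cons map_cat; split=> [[m [/andP[so sm] /andP[sso mq]]]|].
  rewrite run_cat [all _ _]/= so sso.
  by apply/existsP; exists m; apply/andP; split.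
rewrite run_cat => /andP[/andP[so sso] /existsP[m /andP[sm mq]]].
by exists m; split; apply/andP.
Qed.

(** * Factors of the updated word in terms of the old one *)

Section Update.
Variables (V : Type) (o : update_op Sigma).

(* The factor [x, y> of the updated word, cut at the updated position; [v] is
   the successor of that position. *)
Definition new_pieces (v x y : arg V) (inside : bool) : seq (piece V) :=
  if inside then
    Int x (AUpd V) :: map Lit (oseq (op_letter o)) ++ [:: Int v y]
  else [:: Int x y].

(** An uncut factor must lie on one side of the updated position; for a cut one, [pok] of its pieces
    already places that position inside. *)
Definition new_cond (v x y : arg V) (inside : bool) : query Sigma V :=
  fun n W u e =>
    if inside then True
    else aval u e y <= elt u \/ aval u e v <= aval u e x.

Lemma gdef_new_cond v x y b : gdef N (new_cond v x y b).
Proof.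
case: b; first exact: gdef_true.
exact: gdef_or (gdef_le y (AUpd V)) (gdef_le v x).
Qed.

Lemma new_pieces_sound v x y b n (W : wstruct Sigma n) u e :
  aval u e v = u.+1 :> nat ->
  new_cond v x y b W u e -> all (pok u e) (new_pieces v x y b) ->
  aval u e x <= aval u e y /\
  seg (apply_op W o u) (aval u e x) (aval u e y) =
  pvals W u e (new_pieces v x y b).
Proof.
have uE := bump_ord u.
move=> vE; case: b => /=.
  move=> _; rewrite all_cat /= andbT uE vE => /and3P[xu _ uy].
  split; first by apply: leq_trans xu (ltnW uy).
  rewrite seg_apply_in ?xu // /pvals /= map_cat flatten_cat /= uE vE cats0.
  by case: op_letter.
rewrite andbT uE vE => out_u xy; split=> //.
by rewrite seg_apply_out /pvals /= ?cats0 //; apply/orP.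
Qed.

Lemma new_pieces_complete v x y n (W : wstruct Sigma n) u e :
  aval u e v = u.+1 :> nat -> aval u e x <= aval u e y ->
  exists2 b, new_cond v x y b W u e & all (pok u e) (new_pieces v x y b).
Proof.
have uE := bump_ord u.
move=> vE xy; have [yu|uy] := leqP (aval u e y) u.
  by exists false; rewrite /= ?andbT ?uE //; left.
have [xu|ux] := leqP (aval u e x) u; last first.
  by exists false; rewrite /= ?andbT ?vE //; right.
exists true; rewrite // /new_pieces /= all_cat /= uE vE xu uy.
by case: op_letter.
Qed.

End Update.

Lemma succ_ex n (u : 'I_n) : exists v : 'I_n.+1, v == u.+1 :> nat.
Proof. by exists (@Ordinal n.+1 u.+1 (ltn_ord u)). Qed.

(** The successor of the updated element, for which [arg] has no constant, is quantified; then the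
    two ways of cutting the factor are joined by a disjunction. *)
Lemma gdef_new_run (V : Type) o (p q : state N) (x y : arg V) :
  gdef N (fun n W u e =>
    base_sem (apply_op W o u) (Run p q) [:: aval u e x; aval u e y]).
Proof.
pose v : arg (option V) := AVar None.
pose ps b := new_pieces o v (wk x) (wk y) b.
have bdef b := gdef_and (gdef_new_cond v (wk x) (wk y) b) (gdef_runs (ps b) p q).
have vdef := gdef_ex1 (gdef_and (gdef_succ (AUpd _) v) (gdef_exT bdef)).
apply: gdef_iff vdef => n W u e; split.
  case=> w [/eqP wE [b [bc /andP[bok]]]]; rewrite /= bump_ord in wE.
  have wE' : aval u (ocons w e) v = u.+1 :> nat by [].
  have [] := new_pieces_sound (o := o) wE' bc bok; rewrite !aval_wk.
  by move=> xy segE; rewrite -segE => pq; apply/andP; split.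
case/andP=> xy pq; have [w wE] := succ_ex u.
have xy' : aval u (ocons w e) (wk x) <= aval u (ocons w e) (wk y) by rewrite !aval_wk.
have wE' : aval u (ocons w e) v = u.+1 :> nat by apply/eqP.
have [b bc bok] := new_pieces_complete o W wE' xy'.
have [_ segE] := new_pieces_sound (o := o) wE' bc bok.
exists w; split; first by rewrite /= bump_ord.
by exists b; split=> //; rewrite bok /ps -segE !aval_wk.
Qed.

Lemma gdef_new_fac (V : Type) o (x y x' y' : arg V) :
  gdef N (fun n W u e => base_sem (apply_op W o u) (Fac N)
    [:: aval u e x; aval u e y; aval u e x'; aval u e y']).
Proof.
pose v : arg (option V) := AVar None.
pose ps b := new_pieces o v (wk x) (wk y) b.
pose ps' b := new_pieces o v (wk x') (wk y') b.
have bdef b b' := gdef_and (gdef_new_cond v (wk x) (wk y) b)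
  (gdef_and (gdef_new_cond v (wk x') (wk y') b') (gdef_peq (ps b) (ps' b'))).
have vdef := gdef_ex1 (gdef_and (gdef_succ (AUpd _) v)
  (gdef_exT (fun b => gdef_exT (bdef b)))).
apply: gdef_iff vdef => n W u e.
split.
  case=> w [/eqP wE [b [b' [bc [bc' [ok ok' eqv]]]]]]; rewrite /= bump_ord in wE.
  have wE' : aval u (ocons w e) v = u.+1 :> nat by [].
  have [] := new_pieces_sound (o := o) wE' bc ok; rewrite !aval_wk => xy segE.
  have [] := new_pieces_sound (o := o) wE' bc' ok'; rewrite !aval_wk => xy' segE'.
  by rewrite /= xy xy' segE segE' eqv eqxx.
case/and3P=> xy xy' /eqP eqv; have [w wE] := succ_ex u.
have wE' : aval u (ocons w e) v = u.+1 :> nat by apply/eqP.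
rewrite -(aval_wk u w e x) -(aval_wk u w e y) in xy eqv.
rewrite -(aval_wk u w e x') -(aval_wk u w e y') in xy' eqv.
have [b bc ok] := new_pieces_complete o W wE' xy.
have [b' bc' ok'] := new_pieces_complete o W wE' xy'.
have [_ segE] := new_pieces_sound (o := o) wE' bc ok.
have [_ segE'] := new_pieces_sound (o := o) wE' bc' ok'.
exists w; split; first by rewrite /= bump_ord.
by exists b, b'; do !split; rewrite // -segE -segE'.
Qed.

Lemma gdef_new_letter (V : Type) o c (x : arg V) :
  gdef N (fun n W u e => letter_at (apply_op W o u) (aval u e x) == Some c).
Proof.
pose v : arg (option V) := AVar None.
have neq_def := gdef_ex1 (gdef_and (gdef_succ (AUpd _) v) (gdef_le v (wk x))).
have neq_def' := gdef_ex1 (gdef_and (gdef_succ (wk x) v) (gdef_le v (AUpd _))).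
apply: gdef_iff (gdef_or
  (gdef_and (gdef_eq x (AUpd _)) (gdef_bool V (op_letter o == Some c)))
  (gdef_and (gdef_or neq_def neq_def') (gdef_letter c x))) => n W u e.
have uE := bump_ord u.
rewrite !letter_atE nletter_apply; split.
  case=> [[-> oc]|[neq xc]]; first by rewrite /= uE eqxx.
  case: (nat_of_ord (aval u e x) =P u) => // xu.
  by case: neq => -[w []]; rewrite /= aval_wk uE xu; lia.
case: ltngtP => [xu xc|ux xc|xu oc]; last first.
- by left; split=> //; apply: val_inj; rewrite /= xu uE.
- right; split=> //; left; have [w wE] := succ_ex u; exists w.
  by rewrite /= aval_wk uE wE (eqP wE).
right; split=> //; right.
have xn := leq_ltn_trans xu (leqW (ltn_ord u)).
by exists (Ordinal xn); rewrite /= aval_wk uE eqxx.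
Qed.

Lemma gdef_new_base (V : Type) o (R : base N) (ts : (ar R).-tuple (arg V)) :
  gdef N (fun n W u e =>
    base_sem (apply_op W o u) R [seq aval u e a | a <- ts]).
Proof.
case: R ts => [||||a|p q|] /= [[|d [|x [|y [|x' [|y' s]]]]] //= st].
- exact: gdef_le.
- exact: gdef_succ.
- exact: (gdef_base (R := First N) [tuple d]).
- exact: (gdef_base (R := OneTop N) [tuple d; x]).
- exact: gdef_new_letter.
- exact: gdef_new_run.
- exact: gdef_new_fac.
Qed.

End Closure.

(** * Ref-words over marked words *)

Section RefWords.
Local Open Scope fset_scope.
Local Open Scope fmap_scope.
Variable Sigma : finType.
Implicit Types (r : seq (refsym Sigma)) (b : var * bool) (V : {fset var}).

Definition br b : refsym Sigma := if b.2 then Close b.1 else Open b.1.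

Definition is_br b (c : refsym Sigma) : bool :=
  if b.2 then is_close b.1 c else is_open b.1 c.

Definition bracket (c : refsym Sigma) : option (var * bool) :=
  match c with
  | Letter _ => None
  | Open x => Some (x, false)
  | Close x => Some (x, true)
  end.

Definition brs r : seq (var * bool) := pmap bracket r.

Lemma is_brE b c : is_br b c = (bracket c == Some b).
Proof.
by case: b c => x [] [a|y|y] //=;
  rewrite /is_br /= (inj_eq Some_inj) xpair_eqE ?andbT ?andbF.
Qed.

Lemma bracket_br b : bracket (br b) = Some b.
Proof. by case: b => x []. Qed.

Lemma brs_cat r1 r2 : brs (r1 ++ r2) = brs r1 ++ brs r2.
Proof. exact: pmap_cat. Qed.

Lemma brs_letters (w : seq Sigma) : brs [seq Letter a | a <- w] = [::].
Proof. by elim: w. Qed.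

Lemma letters_cat r1 r2 : letters (r1 ++ r2) = letters r1 ++ letters r2.
Proof. exact: pmap_cat. Qed.

Lemma letters_map (w : seq Sigma) : letters [seq Letter a | a <- w] = w.
Proof. by elim: w => //= a w ->. Qed.

Lemma letters_br b r : letters (br b :: r) = letters r.
Proof. by case: b => x []. Qed.

Lemma brs_br b r : brs (br b :: r) = b :: brs r.
Proof. by rewrite /brs /= bracket_br. Qed.

Lemma count_is_br b r : count (is_br b) r = count_mem b (brs r).
Proof.
elim: r => //= c r ->; rewrite is_brE /brs /=.
by case: bracket => //= b'; rewrite (inj_eq Some_inj).
Qed.

(** Letters between brackets do not affect which bracket comes first, so validity of a ref-word
    depends on its bracket sequence alone. *)
Lemma find_is_br_lt b b' r :
  (find (is_br b) r < find (is_br b') r) = (index b (brs r) < index b' (brs r)).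
Proof.
elim: r => //= c r IH; rewrite !is_brE /brs /=.
case: bracket => [b''|] /=; last by rewrite ltnS.
rewrite !(inj_eq Some_inj) /=.
by case: eqP => _; case: eqP => _ //=; rewrite ltnS.
Qed.

Definition valid_brs V (bs : seq (var * bool)) : Prop :=
  forall x, x \in V ->
    [/\ count_mem (x, false) bs = 1, count_mem (x, true) bs = 1
      & index (x, false) bs < index (x, true) bs].

Lemma valid_refE V r : valid_ref V r <-> valid_brs V (brs r).
Proof.
by split=> H x /H; rewrite -!count_is_br -find_is_br_lt.
Qed.

Lemma reflang_brs (g : regex Sigma) r b :
  reflang g r -> b \in brs r -> b.1 \in rvars g.
Proof.
elim: g r => [|||g1 IH1 g2 IH2|g1 IH1 g2 IH2|g IH|x g IH] //= r.
- by move=> ->.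
- by move=> a ->.
- by rewrite in_fsetU => -[/IH1 H /H->|/IH2 H /H->]; rewrite ?orbT.
- case=> r1 [r2 [-> /IH1 H1 /IH2 H2]]; rewrite brs_cat mem_cat in_fsetU.
  by case/orP=> [/H1->|/H2->]; rewrite ?orbT.
- case=> rs [-> ]; elim: rs => //= s rs IHrs [/IH H /IHrs Hs].
  by rewrite brs_cat mem_cat => /orP[].
case=> r1 -> /IH H; rewrite -cats1 -[Open x :: _]cat1s !brs_cat !mem_cat /brs /=.
by rewrite !inE => /or3P[/eqP->|/H->|/eqP->]; rewrite ?eqxx ?orbT.
Qed.

Definition var_brs V : seq (var * bool) :=
  [seq (x, c) | x <- enum_fset V, c <- [:: false; true]].

Lemma mem_var_brs V b : (b \in var_brs V) = (b.1 \in V).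
Proof.
case: b => x c; apply/allpairsP/idP=> [[[y d] [/= yV _ [-> _]]] //|/= xV].
by exists (x, c); split=> //; case: c.
Qed.

Lemma uniq_var_brs V : uniq (var_brs V).
Proof. by apply: allpairs_uniq => //= -[x c] [y d] _ _ []/= -> ->. Qed.

(** Every bracket occurs exactly once, which leaves finitely many bracket orders to try. *)
Lemma valid_brs_perm V bs : {subset bs <= [pred b | b.1 \in V]} ->
  valid_brs V bs -> perm_eq bs (var_brs V).
Proof.
move=> sub_bs val_bs.
have cnt b : b.1 \in V -> count_mem b bs = 1.
  by case: b => x [] /val_bs[].
have memE b : (b \in bs) = (b.1 \in V).
  apply/idP/idP=> [/sub_bs //|bV].
  by rewrite -has_pred1 has_count cnt.
apply: uniq_perm; rewrite ?uniq_var_brs //; last first.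
  by move=> b; rewrite memE mem_var_brs.
apply: count_mem_uniq => b; rewrite memE; have [/cnt-> //|bV] := boolP (b.1 \in V).
by apply/count_memPn; rewrite memE.
Qed.

Lemma letters_take_find b b' w r :
  letters (take (find (is_br b) ([seq Letter a | a <- w] ++ br b' :: r))
                ([seq Letter a | a <- w] ++ br b' :: r)) =
  w ++ (if b' == b then [::] else letters (take (find (is_br b) r) r)).
Proof.
rewrite find_cat; have -> : has (is_br b) [seq Letter a | a <- w] = false.
  by elim: w => //= a w ->; rewrite is_brE.
rewrite take_cat ltnNge leq_addr addKn letters_cat letters_map.
rewrite [find _ (_ :: _)]/= is_brE bracket_br (inj_eq Some_inj).
case: eqP => _; first by rewrite take0.
by rewrite [take _ (_ :: _)]/= letters_br.
Qed.

Lemma brs_nil r : brs r = [::] -> r = [seq Letter a | a <- letters r].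
Proof. by elim: r => [|[a|x|x] r IH] //= /IH{1}->. Qed.

Lemma brs_consP r b bs : brs r = b :: bs ->
  exists w r', r = [seq Letter a | a <- w] ++ br b :: r' /\ brs r' = bs.
Proof.
elim: r => [|[a|x|x] r IH] //=.
- by case/IH=> w [r' [-> <-]]; exists (a :: w), r'.
- by case=> <- <-; exists [::], r.
- by case=> <- <-; exists [::], r.
Qed.

(** * Ref-words determined by an assignment of elements to brackets *)

Section MarkedWords.
Variables (n : nat) (W : wstruct Sigma n) (e : var * bool -> 'I_n.+1).

(* The only ref-word whose letters spell the word from position [z] on, and that
   reads the brackets [bs] in this order, each at its element. *)
Fixpoint mkref (z : nat) (bs : seq (var * bool)) : seq (refsym Sigma) :=
  if bs is b :: bs' then
    [seq Letter a | a <- seg W z (e b)] ++ br b :: mkref (e b) bs'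
  else [seq Letter a | a <- seg W z n].

Fixpoint ordered (z : nat) (bs : seq (var * bool)) : bool :=
  if bs is b :: bs' then (z <= e b) && ordered (e b) bs' else true.

Lemma ordered_leq z bs b : ordered z bs -> b \in bs -> z <= e b.
Proof.
elim: bs z => //= b' bs IH z /andP[zb' bs_ord] /predU1P[->//|b_bs].
exact: leq_trans zb' (IH _ bs_ord b_bs).
Qed.

Lemma brs_mkref z bs : brs (mkref z bs) = bs.
Proof.
elim: bs z => [|b bs IH] z /=; first exact: brs_letters.
by rewrite brs_cat brs_letters brs_br IH.
Qed.

Lemma letters_mkref z bs : z <= n -> ordered z bs ->
  letters (mkref z bs) = seg W z n.
Proof.
elim: bs z => [|b bs IH] z zn /=; first by rewrite letters_map.
case/andP=> zb bs_ord; have bn : e b <= n by rewrite -ltnS.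
by rewrite letters_cat letters_map letters_br IH // -seg_cat.
Qed.

Lemma take_find_mkref z bs b : ordered z bs -> b \in bs ->
  letters (take (find (is_br b) (mkref z bs)) (mkref z bs)) = seg W z (e b).
Proof.
elim: bs z => //= b' bs IH z /andP[zb' bs_ord].
rewrite letters_take_find in_cons eq_sym; case: eqP => [->|_ /= b_bs].
  by rewrite cats0.
by rewrite IH // -seg_cat // (ordered_leq bs_ord).
Qed.

(** By induction on the brackets: the number of letters read before a bracket is prescribed by its
    element, and this forces the factor in front of it. *)
Lemma mkref_unique bs r z :
  brs r = bs -> uniq bs -> z <= n -> letters r = seg W z n ->
  (forall b, b \in bs -> markable W (e b) /\
     (size (seg W 0 z) + size (letters (take (find (is_br b) r) r)))%N =
     size (seg W 0 (e b))) ->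
  ordered z bs /\ r = mkref z bs.
Proof.
elim: bs r z => [|b bs IH] r z.
  by move=> /brs_nil def_r _ _ eq_r _; split=> //; rewrite [LHS]def_r eq_r.
case/brs_consP=> w [r' [-> def_bs]] /= /andP[b_bs bs_uniq] zn eq_r eP.
have [bM] := eP b (mem_head _ _).
rewrite letters_take_find eqxx cats0 => size_w.
(* Markability turns the comparison of letter counts into an order of positions. *)
have zb : z <= e b by rewrite (markable_leq zn bM) -size_w leq_addr.
have bn : e b <= n by rewrite -ltnS.
rewrite letters_cat letters_map letters_br (seg_cat W zb bn) in eq_r.
have size_wE : size w = size (seg W z (e b)).
  by move: size_w; rewrite (seg_cat W (leq0n z) zb) size_cat => /addnI.
have def_w : w = seg W z (e b).
  have := congr1 (take (size w)) eq_r.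
  by rewrite take_size_cat // size_wE take_size_cat.
have eq_r' : letters r' = seg W (e b) n.
  have := congr1 (drop (size w)) eq_r.
  by rewrite drop_size_cat // size_wE drop_size_cat.
have [|bs_ord ->] := IH r' (e b) def_bs bs_uniq bn eq_r'; last first.
  by rewrite zb bs_ord def_w.
move=> b' b'_bs; have [|b'M] := eP b'; first by rewrite in_cons b'_bs orbT.
rewrite letters_take_find; case: eqP => [def_b|_]; first by rewrite def_b b'_bs in b_bs.
by rewrite size_cat addnA size_w.
Qed.

Definition mu_of (V : {fset var}) : span_tuple :=
  [fmap x : V => ((size (seg W 0 (e (val x, false)))).+1,
                  (size (seg W 0 (e (val x, true)))).+1)].

Lemma mu_ofE V x : (mu_of V).[? x] =
  if x \in V then Some ((size (seg W 0 (e (x, false)))).+1,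
                        (size (seg W 0 (e (x, true)))).+1) else None.
Proof. by rewrite /mu_of; case: fndP => xV; rewrite ?ffunE ?xV // (negPf xV). Qed.

Lemma restrict_mu_of (V Y : {fset var}) : Y `<=` V -> (mu_of V).[& Y] = mu_of Y.
Proof.
move=> /fsubsetP YV; apply/fmapP => x; rewrite fnd_restrict !mu_ofE.
by case: ifP => // /YV ->.
Qed.

Definition marked (V : {fset var}) : Prop :=
  forall b, b \in var_brs V -> markable W (e b).

(** A markable element represents only one endpoint, so the assignment determines the span tuple and
    no quantifier over tuples remains. *)
Lemma mu_of_marks V mu : (domf mu = V /\
    forall x, x \in V -> exists2 s, mu.[? x] = Some s &
      marks W (e (x, false)) s.1 /\ marks W (e (x, true)) s.2) <->
  marked V /\ mu = mu_of V.
Proof.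
split=> [[domV muP]|[eM ->]].
  split=> [[x c]|].
    rewrite mem_var_brs => /muP[s _ []]; rewrite !marksE.
    by case: c => /andP[? ?] /andP[? ?].
  apply/fmapP => x; rewrite mu_ofE; case: ifP => [/muP[s ->]|xV].
    by rewrite !marksE => -[/andP[_ /eqP<-] /andP[_ /eqP<-]]; case: s.
  case mux: mu.[? x] => [s|] //.
  by have : x \in V; [rewrite -domV -fndSome mux|rewrite xV].
split=> // x xV; rewrite mu_ofE xV; eexists; first by [].
by rewrite !marksE !eqxx !andbT /=; split; apply: eM; rewrite mem_var_brs.
Qed.

(** Given the tuple, a ref-word is determined by the order of its brackets; the unbounded search for
    a ref-word becomes a finite one. *)
Lemma regex_semE (g : regex Sigma) : marked (rvars g) ->
  regex_sem g (word W) (mu_of (rvars g)) <->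
  exists bs, [/\ bs \in permutations (var_brs (rvars g)), valid_brs (rvars g) bs,
                 ordered 0 bs & reflang g (mkref 0 bs)].
Proof.
move=> eM; split=> [[r [rg /valid_refE rV def_r def_mu]]|].
  have bs_perm : perm_eq (brs r) (var_brs (rvars g)).
    by apply: valid_brs_perm => // b; apply: reflang_brs rg.
  have bs_uniq : uniq (brs r) by rewrite (perm_uniq bs_perm) uniq_var_brs.
  have eq_r : letters r = seg W 0 n by rewrite def_r word_seg.
  have [|bs_ord def_r'] := mkref_unique erefl bs_uniq (leq0n n) eq_r.
    move=> b; rewrite (perm_mem bs_perm) => bV; split; first exact: eM.
    rewrite segnn add0n; move: bV; rewrite mem_var_brs; case: b => x c /= xV.
    have := congr1 (fun mu : span_tuple => mu.[? x]) def_mu.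
    rewrite mu_ofE xV /ref_tuple in_fnd ffunE /ref_span => -[].
    by case: c.
  by exists (brs r); rewrite mem_permutations bs_perm -def_r'.
case=> bs []; rewrite mem_permutations => bs_perm bs_val bs_ord bsg.
exists (mkref 0 bs); split=> //.
- by apply/valid_refE; rewrite brs_mkref.
- by rewrite letters_mkref // word_seg.
apply/fmapP => x; rewrite mu_ofE /ref_tuple.
have [xV|xV] := boolP (x \in rvars g); last by rewrite not_fnd.
rewrite in_fnd ffunE /ref_span.
have find0 c := @take_find_mkref 0 bs (x, c) bs_ord.
by rewrite -find0 -?find0 ?(perm_mem bs_perm) ?mem_var_brs.
Qed.

End MarkedWords.

(* The spanner relation with components named by brackets instead of indices. *)
Definition srel (P : spanner Sigma) n (W : wstruct Sigma n)
    (e : var * bool -> 'I_n.+1) : Prop :=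
  marked W e (svars P) /\ P (word W) (mu_of W e (svars P)).

End RefWords.

(** * Definability of core spanners *)

Section SpannerAlgebra.
Local Open Scope fset_scope.
Local Open Scope fmap_scope.
Variables (Sigma : finType) (n : nat) (W : wstruct Sigma n).
Implicit Type e : var * bool -> 'I_n.+1.

Lemma srel_union (P1 P2 : spanner Sigma) (eqV : svars P1 = svars P2) e :
  srel (union_spanner eqV) W e <-> srel P1 W e \/ srel P2 W e.
Proof.
rewrite /srel /= /union_sem -eqV; split=> [[eM [P1e|P2e]]|[[eM P1e]|[eM P2e]]].
- by left.
- by right.
- by split=> //; left.
- by split=> //; right.
Qed.

Lemma srel_join (P1 P2 : spanner Sigma) e :
  srel (join_spanner P1 P2) W e <-> srel P1 W e /\ srel P2 W e.
Proof.
rewrite /srel /= /join_sem !restrict_mu_of ?fsubsetUl ?fsubsetUr //.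
split=> [[eM [_ P1e P2e]]|[[eM1 P1e] [eM2 P2e]]].
  by split; split=> // b bV; apply: eM; move: bV;
    rewrite !mem_var_brs in_fsetU => ->; rewrite ?orbT.
split=> // b; rewrite mem_var_brs in_fsetU => /orP[bV|bV].
  by apply: eM1; rewrite mem_var_brs.
by apply: eM2; rewrite mem_var_brs.
Qed.

(** Supplies the order of endpoints that [Fac] includes and [factor_seg] requires. *)
Lemma srel_leq (P : spanner Sigma) e x : srel P W e -> x \in svars P ->
  e (x, false) <= e (x, true).
Proof.
case=> eM Pe xV; rewrite (@markable_leq _ _ W) ?leq_ord //; last first.
  by apply: eM; rewrite mem_var_brs.
have [_ /(_ x) spanP] := semP Pe.
by move: spanP; rewrite mu_ofE xV => /(_ _ erefl) /andP[/andP[]].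
Qed.

Lemma srel_eqsel (P : spanner Sigma) x y e :
  x \in svars P -> y \in svars P ->
  srel (eqsel_spanner x y P) W e <->
  srel P W e /\ [&& e (x, false) <= e (x, true), e (y, false) <= e (y, true) &
     seg W (e (x, false)) (e (x, true)) == seg W (e (y, false)) (e (y, true))].
Proof.
move=> xV yV; rewrite {1}/srel /= /eqsel_sem !mu_ofE xV yV /=.
split=> [[eM [Pe eqf]]|[[eM Pe] /and3P[xx yy /eqP eqf]]].
  have Pr : srel P W e by [].
  split=> //; have xx := srel_leq Pr xV; have yy := srel_leq Pr yV.
  rewrite xx yy /=; case: eqf; rewrite !factor_seg ?leq_ord // => ->.
  exact: eqxx.
by split=> //; split=> //; rewrite !factor_seg ?leq_ord // eqf.
Qed.

(** Projection can become quantification over elements because every endpoint of a discarded span is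
    represented by some element. *)
Lemma srel_proj (Y : {fset var}) (P : spanner Sigma) (subY : Y `<=` svars P) e :
  srel (proj_spanner subY) W e <->
  exists2 e', (forall b, b.1 \in Y -> e' b = e b) & srel P W e'.
Proof.
split=> [[/= eM [nu Pnu eq_nu]]|[e' e'Y [e'M Pe']]]; last first.
  have muY : mu_of W e Y = mu_of W e' Y.
    by apply/fmapP => x; rewrite !mu_ofE; case: ifP => // xY; rewrite !e'Y.
  split=> /= [b|].
    rewrite mem_var_brs => bY; rewrite -e'Y //; apply: e'M.
    by rewrite mem_var_brs (fsubsetP subY).
  by exists (mu_of W e' (svars P)); rewrite ?restrict_mu_of.
have [domV spanP] := semP Pnu.
pose coord (c : bool) (s : span) := if c then s.2 else s.1.
(* Discarded variables of [P] get elements marking their endpoints in [nu]; there the default $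
   never arises, by [marks_ex]. *)
pose e' b := if b.1 \in Y then e b
  else odflt ord_max
    [pick y | if nu.[? b.1] is Some s then marks W y (coord b.2 s) else true].
exists e' => [b bY|]; first by rewrite /e' bY.
suff [e'M def_nu] : marked W e' (svars P) /\ nu = mu_of W e' (svars P).
  by split; rewrite // -def_nu.
apply/mu_of_marks; split=> // x xV.
case nux: nu.[? x] => [s|]; last by move: xV; rewrite -domV -fndSome nux.
exists s => //; have s_span := spanP _ _ nux; rewrite /e' /=.
have [xY|xY] := boolP (x \in Y).
  have := congr1 (fun mu : span_tuple => mu.[? x]) eq_nu.
  rewrite fnd_restrict mu_ofE xY nux => -[<-].
  by rewrite !marksE !eqxx !andbT; split; apply: eM; rewrite mem_var_brs.
rewrite nux /=; case/andP: s_span => /andP[s1 s12] s2.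
have [y1 m1] : exists y : 'I_n.+1, marks W y s.1.
  by apply: marks_ex; rewrite s1 (leq_trans s12).
have [y2 m2] : exists y : 'I_n.+1, marks W y s.2.
  by apply: marks_ex; rewrite s2 (leq_trans s1).
by split; case: pickP => [//|]; [move/(_ y1)|move/(_ y2)]; rewrite ?m1 ?m2.
Qed.

End SpannerAlgebra.

(** * Definability of the spanner operations after an update *)

Section Definability.
Local Open Scope fset_scope.
Variables (Sigma : finType) (N : nfa (refsym Sigma)) (o : update_op Sigma).

Definition srel_def (P : spanner Sigma) : Prop :=
  gdef N (fun n W u e => srel P (apply_op W o u) e).

Lemma gdef_markable (V : Type) (a : arg V) :
  gdef N (fun n W u e => markable (apply_op W o u) (aval u e a)).
Proof.
have ldef := gdef_has (enum Sigma) (fun c => gdef_new_letter N o c a).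
apply: gdef_iff (gdef_or (gdef_eq N a (AEnd _)) ldef) => n W u e.
rewrite /markable; split=> [[->|[c _ /eqP->]]|/orP[/eqP->|]]; rewrite ?eqxx ?orbT //.
  by left.
by case: letter_at => // c _; right; exists c; rewrite ?mem_enum.
Qed.

Lemma gdef_marked (V : {fset var}) :
  gdef N (fun n W u e => marked (apply_op W o u) e V).
Proof.
exact: (gdef_all (s := var_brs V) (fun b _ => gdef_markable (AVar b))).
Qed.

(** The states before and after each bracket are guessed, and the factors between brackets are runs
    on the updated word, the last one up to $. The variable [None] is reserved for the starting
    position. *)
Lemma gdef_chain bs (p q : state N) (z : arg (option (var * bool))) :
  gdef N (fun n W u e =>
    ordered (fun b => e (Some b)) (aval u e z) bs &&
    run p (mkref (apply_op W o u) (fun b => e (Some b)) (aval u e z) bs) q).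
Proof.
elim: bs p z => [|b bs IH] p z.
  apply: gdef_iff (gdef_new_run o p q z (AEnd _)) => n W u e /=.
  by rewrite -ltnS ltn_ord.
have mdef m m' := gdef_and (gdef_new_run o p m z (AVar (Some b)))
  (gdef_and (gdef_bool N _ (step m (br Sigma b) m')) (IH m' (AVar (Some b)))).
apply: gdef_iff (gdef_exT (fun m => gdef_exT (mdef m))) => n W u e.
rewrite [ordered _ _ _]/= [mkref _ _ _ _]/=; split.
  case=> m [m' [/andP[zb pm] [mm' /andP[b_ord m'q]]]].
  apply/andP; split; first by apply/andP.
  rewrite run_cat; apply/existsP; exists m; apply/andP; split=> //.
  by rewrite run_cons; apply/existsP; exists m'; apply/andP.
rewrite run_cat => /andP[/andP[zb b_ord] /existsP[m /andP[pm]]].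
rewrite run_cons => /existsP[m' /andP[mm' m'q]].
by exists m, m'; split; [apply/andP|split=> //; apply/andP].
Qed.

Lemma gdef_regex (g : regex Sigma) : recognizes N (reflang g) ->
  srel_def (regex_spanner g).
Proof.
case=> I NI; pose z : arg (option (var * bool)) := AVar None.
(* A boolean form of validity, used to filter the bracket orders. *)
have [val valP] : exists val : pred (seq (var * bool)),
    forall bs, val bs <-> valid_brs (rvars g) bs.
  exists (fun bs => all (fun x => [&& count_mem (x, false) bs == 1,
    count_mem (x, true) bs == 1 & index (x, false) bs < index (x, true) bs])
    (enum_fset (rvars g))) => bs.
  split=> [/allP H x /H /and3P[/eqP-> /eqP-> ->] //|H].
  by apply/allP => x /H[-> -> ->].
have cdef bs := gdef_has (enum I) (fun p =>
  gdef_has [seq q <- enum (state N) | final q] (fun q => gdef_chain bs p q z)).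
(* [First] forces [z] to be the first element, so the whole word is read. *)
have zdef bs := gdef_ex1 (gdef_and (gdef_base (R := First N) [tuple z]) (cdef bs)).
have bsdef := gdef_has [seq bs <- permutations (var_brs (rvars g)) | val bs] zdef.
apply: gdef_iff (gdef_and (gdef_marked (rvars g)) bsdef) => n W u e.
rewrite /srel /=; split=> -[eM].
  case=> bs; rewrite mem_filter => /andP[/valP bs_val bs_perm].
  case=> x [/eqP x0 [p pI [q]]]; rewrite mem_filter => /andP[qF _].
  rewrite x0 => /andP[bs_ord pq].
  split=> //; apply/regex_semE => //; exists bs; split=> //.
  apply/NI; exists p; first by rewrite -mem_enum.
  by apply/existsP; exists q; rewrite qF andbT.
case/regex_semE=> // bs [bs_perm bs_val bs_ord /NI[p pI /existsP[q /andP[pq qF]]]].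
split=> //; exists bs; first by rewrite mem_filter bs_perm andbT; apply/valP.
exists ord0; split=> //; exists p; first by rewrite mem_enum.
exists q; first by rewrite mem_filter qF mem_enum.
by apply/andP; split.
Qed.

Lemma gdef_union (P1 P2 : spanner Sigma) (eqV : svars P1 = svars P2) :
  srel_def P1 -> srel_def P2 -> srel_def (union_spanner eqV).
Proof.
move=> P1def P2def; apply: gdef_iff (gdef_or P1def P2def) => n W u e.
by rewrite srel_union.
Qed.

Lemma gdef_join (P1 P2 : spanner Sigma) :
  srel_def P1 -> srel_def P2 -> srel_def (join_spanner P1 P2).
Proof.
move=> P1def P2def; apply: gdef_iff (gdef_and P1def P2def) => n W u e.
by rewrite srel_join.
Qed.

Lemma gdef_eqsel (P : spanner Sigma) x y : x \in svars P -> y \in svars P ->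
  srel_def P -> srel_def (eqsel_spanner x y P).
Proof.
move=> xV yV Pdef.
apply: gdef_iff (gdef_and Pdef (gdef_new_fac N o (AVar (x, false)) (AVar (x, true))
  (AVar (y, false)) (AVar (y, true)))) => n W u e.
by rewrite srel_eqsel.
Qed.

Lemma gdef_proj (Y : {fset var}) (P : spanner Sigma) (subY : Y `<=` svars P) :
  srel_def P -> srel_def (proj_spanner subY).
Proof.
move=> Pdef; pose F := (svars P * bool)%type.
(* The brackets of discarded variables become quantified variables. *)
pose f (b : var * bool) : arg ((var * bool) + F) :=
  if b.1 \in Y then AVar (inl b) else
  if insub b.1 is Some x then AVar (inr (x, b.2)) else AVar (inl b).
apply: gdef_iff (gdef_ex (F := F) f Pdef) => n W u e; rewrite srel_proj.
split=> [[b Pb]|[e' e'Y Pe']].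
  by eexists; last exact: Pb; move=> v vY; rewrite /f vY.
exists (fun x => e' (val x.1, x.2)); case: Pe' => e'M Pe'.
have fE v : v.1 \in svars P -> aval u (fun x => match x with
    inl v => e v | inr x => e' (val x.1, x.2) end) (f v) = e' v.
  move=> vV; rewrite /f; case: ifP => [/e'Y //|_].
  by rewrite insubT /=; case: v {vV}.
split=> [v|].
  by rewrite mem_var_brs => /[dup] vV /fE->; apply: e'M; rewrite mem_var_brs.
move: Pe'; congr (P _ _); apply/fmapP => x; rewrite !mu_ofE.
by case: ifP => // xV; rewrite !fE.
Qed.

End Definability.

(** The regex formulas are collected before the automaton is fixed, because one automaton has to
    serve them all. *)
Lemma core_srel_def (Sigma : finType) (P : spanner Sigma) : core_spanner P ->
  exists gs : seq (regex Sigma), forall N,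
    foldr (fun g H => recognizes N (reflang g) /\ H) True gs ->
    forall o, srel_def N o P.
Proof.
have foldr_cat_and (N : nfa (refsym Sigma)) gs1 gs2 :
    foldr (fun g H => recognizes N (reflang g) /\ H) True (gs1 ++ gs2) ->
    foldr (fun g H => recognizes N (reflang g) /\ H) True gs1 /\
    foldr (fun g H => recognizes N (reflang g) /\ H) True gs2.
  by elim: gs1 => //= g gs IH [gN /IH[]]; split.
elim=> {P} [g _|P1 P2 eqV _ [gs1 H1] _ [gs2 H2]|Y P subY _ [gs H]
           |P1 P2 _ [gs1 H1] _ [gs2 H2]|x y P xV yV _ [gs H]].
- by exists [:: g] => N [gN _] o; apply: gdef_regex.
- exists (gs1 ++ gs2) => N /foldr_cat_and[N1 N2] o.
  by apply: gdef_union; [apply: H1|apply: H2].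
- by exists gs => N gsN o; apply: gdef_proj; apply: H.
- exists (gs1 ++ gs2) => N /foldr_cat_and[N1 N2] o.
  by apply: gdef_join; [apply: H1|apply: H2].
- by exists gs => N gsN o; apply: gdef_eqsel => //; apply: H.
Qed.

(** * From bracket assignments to tuples, and initialization *)

Section Final.
Local Open Scope fset_scope.
Local Open Scope fmap_scope.
Variables (Sigma : finType) (P : spanner Sigma) (xs : seq var).
Hypotheses (xs_uniq : uniq xs) (xsE : xs =i svars P).

Definition env_of n (t : seq 'I_n.+1) (b : var * bool) : 'I_n.+1 :=
  nth ord_max t ((index b.1 xs).*2 + b.2)%N.

Lemma spanner_relationE n (W : wstruct Sigma n) (t : seq 'I_n.+1) :
  spanner_relation P xs W t <-> srel P W (env_of t).
Proof.
split=> [[mu Pmu muP]|[eM Pe]].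
  suff [eM def_mu] :
      marked W (env_of t) (svars P) /\ mu = mu_of W (env_of t) (svars P).
    by split; rewrite // -def_mu.
  apply/mu_of_marks; split=> [|x]; first by have [] := semP Pmu.
  rewrite -xsE -index_mem => /[dup] x_xs /muP[s].
  rewrite nth_index -?index_mem // => mux [m1 m2]; exists s => //.
  by rewrite /env_of /= addn0 addn1.
exists (mu_of W (env_of t) (svars P)) => // i lt_i.
have iV : nth 0 xs i \in svars P by rewrite -xsE mem_nth.
have /mu_of_marks[_ /(_ _ iV)] := conj eM (erefl (mu_of W (env_of t) (svars P))).
by rewrite /env_of /= index_uniq // addn0 addn1.
Qed.

Lemma nth_map_ord n k (e : 'I_k -> 'I_n.+1) i :
  nth ord_max [seq e j | j <- enum 'I_k] i =
  if insub i is Some j then e j else ord_max.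
Proof.
case: insubP => [j lt_i <-|ge_i].
  by rewrite (nth_map j) ?size_enum_ord ?ltn_ord // nth_ord_enum.
by rewrite nth_default // size_map size_enum_ord leqNgt.
Qed.

(** Without letters only $ is markable, and the sole span of the empty word is [(1, 1)]. *)
Lemma srel_empty n (e : var * bool -> 'I_n.+1) :
  srel P (empty_wstruct Sigma n) e <->
  (forall b, b.1 \in svars P -> e b = ord_max) /\
  P [::] [fmap x : svars P => (1, 1)].
Proof.
have emptyM y : markable (empty_wstruct Sigma n) y = (y == ord_max).
  by rewrite /markable letter_atE /nletter; case: insub => [i|] /=;
    rewrite ?ffunE ?orbF.
rewrite /srel word_seg seg_empty.
have -> : mu_of (empty_wstruct Sigma n) e (svars P) = [fmap x : svars P => (1, 1)].
  by apply/fmapP => x; rewrite mu_ofE !seg_empty; case: fndP => xV;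
     rewrite ?ffunE ?xV // (negPf xV).
split=> -[eM Pe]; split=> // b.
  by rewrite -mem_var_brs => /eM; rewrite emptyM => /eqP.
by rewrite mem_var_brs emptyM => /eM ->.
Qed.

(** Whether [P] selects the only possible tuple on the empty word does not depend on [n]. Excluded
    middle decides it, and the formula is then false or says that all components are $. *)
Lemma init_fo : exists phi : fo Sigma (of_void nat) (2 * size xs),
  forall n (t : (2 * size xs).-tuple 'I_n.+1),
    sat (empty_wstruct Sigma n) (fun v : void => of_void _ v) phi t <->
    spanner_relation P xs (empty_wstruct Sigma n) t.
Proof.
have [P0|nP0] := classic (P [::] [fmap x : svars P => (1, 1)]); last first.
  exists (FNot (FEq _ _ End End)) => n t; rewrite spanner_relationE srel_empty /= eqxx.
  by split=> // -[].
exists (conjn [seq FEq _ _ (Var i) End | i <- enum 'I_(2 * size xs)]) => n t.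
rewrite spanner_relationE srel_empty sat_conjn all_map; split=> [/allP tE|[tE _]].
  split=> // -[x c] /=; rewrite -xsE -index_mem => lt_x.
  have lt_i : (index x xs).*2 + c < 2 * size xs.
    move: lt_x; rewrite -muln2; move: (index x xs) (size xs) => j m.
    by case: c => /=; lia.
  have := tE (Ordinal lt_i); rewrite mem_enum => /(_ isT) /eqP.
  by rewrite /= (tnth_nth ord_max).
apply/allP => i _ /=; rewrite (tnth_nth ord_max).
have lt_i : i./2 < size xs by have := ltn_ord i; lia.
have := tE (nth 0 xs i./2, odd i); rewrite /env_of /= -xsE mem_nth // => /(_ isT).
by rewrite index_uniq // addnC odd_double_half => ->.
Qed.

End Final.

Theorem mainTheorem18 (Sigma : finType) (P : spanner Sigma) (xs : seq var) :
  core_spanner P -> uniq xs -> xs =i svars P ->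
  in_DynCQ (2 * size xs) (spanner_relation P xs).
Proof.
move=> /core_srel_def[gs gsP] xs_uniq xsE.
have [N /gsP Pdef] := common_nfa gs (@reflang_regular Sigma).
apply: (dyncq_of_gdef (N := N)) (init_fo xs_uniq xsE) => [o R|o].
  pose ts := mktuple (fun i : 'I_(ar R) => AVar i).
  apply: gdef_iff (gdef_new_base o ts) => n W u e.
  by rewrite -map_comp.
(* Brackets without a component go to $, matching the default value in [env_of]. *)
pose f (b : var * bool) : arg 'I_(2 * size xs) :=
  if insub ((index b.1 xs).*2 + b.2)%N is Some i then AVar i else AEnd _.
have fdef := gdef_subst f (Pdef o); apply: gdef_iff fdef => n W u e.
have fE b : aval u e (f b) = env_of xs [seq e i | i <- enum 'I_(2 * size xs)] b.
  by rewrite /env_of nth_map_ord /f; case: insub.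
rewrite spanner_relationE //; split; apply: (gdef_ext (N := N)) (Pdef o) _ => b;
  by rewrite fE.
Qed.
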